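(* Let $m\in\mathbb N$, let $B$ be a real skew-symmetric $m\times m$ matrix with trivial kernel, and let $\mathcal G$ be the associated step-two group (see context) with $Q=m+2$. Let $p\ge2$, $\theta\in\mathbb R$, and let $\rho_B(z,t)=(|z|_B^4+t^2)^{1/4}$ with $|z|_B=\tfrac12\sqrt{\langle z,(-B^2)^{1/2}z\rangle}$. Let $\lambda_{\min}(B)$ be the smallest eigenvalue of the symmetric positive definite matrix $(-B^2)^{1/2}$. Then \[ c(\rho_B,p,\theta)\ge\begin{cases}\left(\frac{\lambda_{\min}(B)}{4}\right)^{p/2}\left|\frac{Q-p\theta}{p}\right|^p\left|\frac{Q-2}{Q}\right|^p & \text{if } p\theta\in\left[\left(1-\sqrt{\tfrac32}\right)Q,\left(1+\sqrt{\tfrac32}\right)Q\right],\\[1ex] \left(\frac{\lambda_{\min}(B)}{4}\right)^{p/2}\left(\frac32\right)^{p/2}\frac{\left(3p\theta(p\theta-2Q)\right)^{p/4}}{|p\theta-Q|^{p/2}}\left|\frac{Q-2}{p}\right|^p & \text{otherwise.}\end{cases} \] In particular, $c(\rho_B,2,1)\ge\frac{\lambda_{\min}(B)}{4}\,\frac{(Q-2)^4}{4Q^2}$.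
   Context: $\mathcal G$ is $\mathbb R^m\times\mathbb R$ with coordinates $(z,t)$ and group law $(z,t)\circ(\eta,\tau)=(z+\eta,t+\tau+\tfrac12\langle Bz,\eta\rangle)$, dilations $\delta_\gamma(z,t)=(\gamma z,\gamma^2t)$, $Q=m+2$. Horizontal vector fields $X_i=\partial_{z_i}+\tfrac12(Bz)_i\partial_t$, $\nabla_{\mathcal G}u=(X_1u,\dots,X_mu)$ with Euclidean norm. For a positive homogeneous $d$ (continuous, $d(\delta_\lambda(z,t))=\lambda d(z,t)$ for $\lambda>0$, $d>0$ off the origin), $p\ge2$, $\theta\in\mathbb R$, \[ c(d,p,\theta)=\sup\Big\{c\ge0:\int_{\mathcal G}\frac{|\nabla_{\mathcal G}u|^p}{d^{p(\theta-1)}}dz\,dt\ge c\int_{\mathcal G}\frac{|u|^p}{d^{p\theta}}dz\,dt\ \ \forall u\in C_c^\infty(\mathcal G\setminus\{0\})\Big\}. \] *)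

(* Defs.v *)
From HB Require Import structures.
From mathcomp Require Import all_boot all_order all_algebra.
From mathcomp Require Import all_classical all_reals all_analysis.
Set Implicit Arguments. Unset Strict Implicit. Unset Printing Implicit Defensive.
Import Order.TTheory GRing.Theory Num.Theory.
Import numFieldNormedType.Exports.
Local Open Scope classical_set_scope.
Local Open Scope ring_scope.

Section Defs.
Variable R : realType.

(* Points of G = R^m x R are row vectors of length m + 1:
   the first m coordinates are z, the last one is t. *)
Definition zcoord (m : nat) (x : 'rV[R]_(m + 1)) : 'rV[R]_m := lsubmx x.
Definition tcoord (m : nat) (x : 'rV[R]_(m + 1)) : R := rsubmx x 0 0.

Definition dir_z (m : nat) (i : 'I_m) : 'rV[R]_(m + 1) := delta_mx 0 (lshift 1 i).
Definition dir_t (m : nat) : 'rV[R]_(m + 1) := delta_mx 0 (rshift m ord0).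

Definition Bz (m : nat) (B : 'M[R]_m) (z : 'rV[R]_m) (i : 'I_m) : R :=
  \sum_(j < m) B i j * z 0 j.

Definition Xfield (m : nat) (B : 'M[R]_m) (i : 'I_m)
  (u : 'rV[R]_(m + 1) -> R) (x : 'rV[R]_(m + 1)) : R :=
  'D_(dir_z i) u x + 2^-1 * Bz B (zcoord x) i * 'D_(dir_t m) u x.

Definition hgrad_norm (m : nat) (B : 'M[R]_m)
  (u : 'rV[R]_(m + 1) -> R) (x : 'rV[R]_(m + 1)) : R :=
  Num.sqrt (\sum_(i < m) (Xfield B i u x) ^+ 2).

Fixpoint iter_partial (n : nat) (ks : seq 'I_n) (u : 'rV[R]_n -> R)
  : 'rV[R]_n -> R :=
  match ks with
  | [::] => u
  | k :: ks' => fun x => 'D_(delta_mx 0 k) (iter_partial ks' u) x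
  end.

Definition smooth (n : nat) (u : 'rV[R]_n -> R) : Prop :=
  forall (ks : seq 'I_n) (x : 'rV[R]_n), differentiable (iter_partial ks u) x.

Definition test_fun (m : nat) (u : 'rV[R]_(m + 1) -> R) : Prop :=
  smooth u /\
  exists K : set 'rV[R]_(m + 1),
    [/\ compact K, ~ K 0 & forall x, ~ K x -> u x = 0].

(* Lebesgue integral over R^n of a nonnegative extended-real function,
   computed as an iterated integral of one-dimensional Lebesgue integrals
   (equal to the n-dimensional Lebesgue integral by Tonelli). *)
Fixpoint rv_int (n : nat) : ('rV[R]_n -> \bar R) -> \bar R :=
  match n with
  | 0 => fun f => f 0
  | k.+1 => fun f =>
      (\int[@lebesgue_measure R]_(a in setT)
          rv_int (fun y : 'rV[R]_k => f (row_mx (const_mx a : 'rV[R]_1) y)))%E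
  end.

Definition hardy_const (m : nat) (B : 'M[R]_m) (d : 'rV[R]_(m + 1) -> R)
  (p theta : R) : \bar R :=
  ereal_sup [set (c%:E)%E | c in
    [set c : R | 0 <= c /\
      forall u, test_fun u ->
        (c%:E * rv_int (fun x => ((`| u x | `^ p) / (d x `^ (p * theta)))%:E)
         <= rv_int (fun x => ((hgrad_norm B u x `^ p) /
                               (d x `^ (p * (theta - 1))))%:E))%E]].

(* |z|_B = 1/2 sqrt(<z, S z>) with S = (-B^2)^{1/2} *)
Definition normB (m : nat) (S : 'M[R]_m) (z : 'rV[R]_m) : R :=
  2^-1 * Num.sqrt ((z *m S *m z^T) 0 0).

Definition rhoB (m : nat) (S : 'M[R]_m) (x : 'rV[R]_(m + 1)) : R :=
  (normB S (zcoord x) ^+ 4 + tcoord x ^+ 2) `^ (4^-1).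

End Defs.

(* Main.v *)
Require Import Defs.
From HB Require Import structures.
From mathcomp Require Import all_boot all_order all_algebra.
From mathcomp Require Import all_classical all_reals all_analysis.
From mathcomp Require Import ring lra.
Import Order.TTheory GRing.Theory Num.Theory.
Import numFieldNormedType.Exports.
Local Open Scope classical_set_scope.
Local Open Scope ring_scope.

(** Put [psi = |z|_B^2 = <z, S z> / 4], [q = psi^2 + t^2 = rho_B^4] and
    [J = S^-1 B], where [S = (-B^2)^(1/2)] commutes with [B].  With
    [a = - p theta], [D = Q + a] and [b = a / D], the horizontal field with
    coefficients
      [v = q^(a/4) z - b q^(a/4 - 1) psi (psi z + t J z)]
    has horizontal divergence exactly [m q^(a/4) = m rho_B^(- p theta)], while
      [<v, S v> = 4 psi q^(a/2) (1 - (1 - Q^2 / D^2) psi^2 / q)].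
    Since [lambda_min |v|^2 <= <v, S v>], bounding the profile
    [s (1 - (1 - Q^2 / D^2) s^2)] of [s = psi / sqrt q] on [[0, 1]] gives
    [|v| <= M rho_B^(1 - p theta)]; its maximum is at [s = 1] or in the interior
    according to whether [2 D^2 <= 3 Q^2], which is the case distinction of the
    theorem.  Integrating [div (v |u|^p)] and applying Young's inequality yields
    the Hardy inequality with constant [(m / (p M))^p].

    The divergence of a compactly supported field has zero integral because
    difference quotients do, by translation invariance, and they converge
    uniformly to the derivative; no Fubini theorem is needed. *)

Set Implicit Arguments. Unset Strict Implicit. Unset Printing Implicit Defensive.

(** * Integrals over the line of continuous functions with bounded support *)

Section OneDim.
Variable R : realType.
Notation mu := (@lebesgue_measure R).

Lemma integrable_compact_support (M : R) (f : R -> R) :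
  continuous f -> (forall a, M <= `|a| -> f a = 0) ->
  mu.-integrable setT (EFin \o f).
Proof.
move=> fc f0.
have -> : EFin \o f = (EFin \o f) \_ `[- M, M]%classic.
  apply/funext => x; rewrite patchE; case: ifPn => //=.
  rewrite notin_setE/= in_itv/= => /negP xM; rewrite f0//.
  by rewrite leNgt; apply: contra xM; rewrite ltr_norml => /andP[/ltW -> /ltW ->].
apply: (integrable_mkcond (mu := mu) (D := `[- M, M]%classic) (EFin \o f) _).1 => //.
apply: (@continuous_compact_integrable _ f); [exact: segment_compact|exact: continuous_subspaceT].
Qed.

(** Substitution is applied to nonnegative integrands only, so [f] is written as (f + |f|) - |f|, a
    difference of nonnegative continuous functions vanishing wherever [f] does. *)
Lemma Rintegral_translation (M h : R) (f : R -> R) :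
  continuous f -> (forall a, M <= `|a| -> f a = 0) ->
  \int[mu]_x f (x + h) = \int[mu]_x f x.
Proof.
have ge0 (g : R -> R) : continuous g -> (forall x, 0 <= g x) ->
    \int[mu]_x g (x + h) = \int[mu]_x g x.
  move=> gc g0; rewrite /Rintegral; congr fine.
  have dF x : is_derive x (1 : R) (fun x : R => x + h) 1.
    exact: is_derive_shift.
  have F1 : (fun x : R => x + h)^`()%classic = cst 1.
    by apply/funext => x; rewrite derive1E derive_val.
  rewrite [RHS](increasing_ge0_integration_by_substitutionT (F := fun x => x + h))//.
  - by rewrite F1; apply: eq_integral => x _ /=; rewrite mulr1.
  - by move=> x y; rewrite ltrD2r.
  - by rewrite F1 => x; exact: cvg_cst.
  - by rewrite F1; exact: is_cvg_cst.
  - by rewrite F1; exact: is_cvg_cst.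
  - exact: cvg_addrr_Ny.
  - exact: cvg_addrr.
move=> fc f0.
have M' : forall a, M + `|h| <= `|a| -> M <= `|a + h|.
  move=> a aM; have := lerB_normD a h; lra.
have fch : continuous (fun x => f (x + h)).
  by move=> x; apply: (cvg_comp (+%R^~ h) f _ (fc _)); apply: cvgD; [exact: cvg_id|exact: cvg_cst].
have nc (g : R -> R) : continuous g -> continuous (fun x => `|g x|).
  by move=> gc x; apply: cvg_norm; exact: gc.
have E (g : R -> R) N : continuous g -> (forall a, N <= `|a| -> g a = 0) ->
    \int[mu]_x g x = \int[mu]_x (g x + `|g x|) - \int[mu]_x `|g x|.
  move=> gc g0.
  rewrite -RintegralB//.
  - by apply: eq_Rintegral => x _; rewrite addrK.
  - apply: (@integrable_compact_support N) => [x|a /g0 ->]; last by rewrite normr0 addr0.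
    by apply: cvgD; [exact: gc|exact: nc].
  - apply: (@integrable_compact_support N) => [|a /g0 ->]; last by rewrite normr0.
    exact: nc.
rewrite (E f M)// (E _ (M + `|h|))//; last by move=> a /M' /f0.
rewrite (ge0 (fun x => `|f x|))//; last exact: nc.
rewrite (ge0 (fun x => f x + `|f x|))//.
- by move=> x; apply: cvgD; [exact: fc|exact: nc].
- by move=> x; have := ler_norm (- f x); rewrite normrN; lra.
Qed.

Lemma norm_Rintegral_le (M e : R) (f : R -> R) : 0 <= M -> 0 <= e ->
  continuous f -> (forall a, M <= `|a| -> f a = 0) -> (forall a, `|f a| <= e) ->
  `|\int[mu]_x f x| <= e * (2 * M).
Proof.
move=> M0 e0 fc f0 fe.
have i1 := @integrable_compact_support M f fc f0.
apply: (le_trans (le_normr_Rintegral measurableT i1)).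
have -> : \int[mu]_x `|f x| = \int[mu]_(x in `[- M, M]) `|f x|.
  rewrite [RHS]Rintegral_mkcond; apply: eq_Rintegral => x _.
  rewrite patchE; case: ifPn => //; rewrite notin_setE/= in_itv/= => /negP xM.
  rewrite f0 ?normr0// leNgt; apply: contra xM.
  by rewrite ltr_norml => /andP[/ltW -> /ltW ->].
have nc : continuous (fun x => `|f x : R|).
  by move=> x; apply: cvg_norm; exact: fc.
apply: (@le_trans _ _ (\int[mu]_(x in `[- M, M]) cst e x)).
  apply: le_Rintegral => //.
  - by apply: (@continuous_compact_integrable _ (fun x => `|f x|)); [exact: segment_compact|exact: continuous_subspaceT].
  - by apply: (@continuous_compact_integrable _ (cst e)); [exact: segment_compact|apply: continuous_subspaceT => x; exact: cvg_cst].
rewrite Rintegral_cst//= lebesgue_measure_itv/= lte_fin.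
case: ifPn => [_|]; last by rewrite mulr0 mulr_ge0// mulr_ge0.
by rewrite -EFinB/= opprK mulr_natl mulr2n.
Qed.
End OneDim.

(** * Iterated integrals: linearity, bounds, translation invariance, vanishing integral of a
    derivative *)

Section IteratedIntegral.
Variable R : realType.
Notation mu := (@lebesgue_measure R).

(** The same block form as in [rv_int], so that the slices of the two iterated integrals agree by
    conversion. *)
Definition row_cons n (a : R) (y : 'rV[R]_n) : 'rV[R]_n.+1 := row_mx (const_mx a : 'rV[R]_1) y.

Definition slice (n : nat) (f : 'rV[R]_n.+1 -> R) (a : R) : 'rV[R]_n -> R :=
  fun y => f (row_cons a y).

(** Real-valued counterpart of [rv_int], in which differences of integrals make sense; [rv_int_EFin]
    identifies the two on [ucs] functions. *)
Fixpoint rv_Rint (n : nat) : ('rV[R]_n -> R) -> R :=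
  match n with
  | 0 => fun f => f 0
  | k.+1 => fun f => \int[mu]_a rv_Rint (slice f a)
  end.

(* Uniformly continuous and supported in the cube of half-side [M]; the condition is
   coordinatewise so that it passes to slices. *)
Definition ucs (M : R) (n : nat) (f : 'rV[R]_n -> R) : Prop :=
  (forall e, 0 < e -> exists2 d, 0 < d &
     forall x y : 'rV[R]_n, (forall i, `|x 0 i - y 0 i| < d) -> `|f x - f y| < e)
  /\ forall (x : 'rV[R]_n) i, M <= `|x 0 i| -> f x = 0.

Lemma ucs_le M N n (f : 'rV[R]_n -> R) : M <= N -> ucs M f -> ucs N f.
Proof. by move=> MN [uf f0]; split=> // x i /(le_trans MN)/f0. Qed.

Lemma ucs_lin M n c (f g : 'rV[R]_n -> R) : ucs M f -> ucs M g ->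
  ucs M (fun x => c * f x + g x).
Proof.
move=> [uf f0] [ug g0]; split=> [e e0|x i Mx]; last by rewrite (f0 _ i)// (g0 _ i)// mulr0 addr0.
have c1 : 0 < `|c| + 1 by rewrite ltr_pwDr.
have [|d d0 df] := uf (e / 2 / (`|c| + 1)); first by rewrite !divr_gt0.
have [|d' d'0 dg] := ug (e / 2); first by rewrite divr_gt0.
exists (Num.min d d'); first by rewrite lt_min d0.
move=> x y xy.
have xyd i : `|x 0 i - y 0 i| < d by have := xy i; rewrite lt_min => /andP[].
have xyd' i : `|x 0 i - y 0 i| < d' by have := xy i; rewrite lt_min => /andP[].
have -> : c * f x + g x - (c * f y + g y) = c * (f x - f y) + (g x - g y) by ring.
apply: (le_lt_trans (ler_normD _ _)); rewrite normrM.
have {df}/ltW := df _ _ xyd; rewrite ler_pdivlMr// => h1.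
have h2 := dg _ _ xyd'.
have := normr_ge0 (f x - f y); nra.
Qed.

Lemma row_consl n a (y : 'rV[R]_n) (j : 'I_1) : row_cons a y 0 (lshift n j) = a.
Proof. by rewrite /row_cons (@row_mxEl _ 1 1 n) mxE. Qed.

Lemma row_consr n a (y : 'rV[R]_n) j : row_cons a y 0 (rshift 1 j) = y 0 j.
Proof. exact: (@row_mxEr _ 1 1 n). Qed.

Lemma ord_consP n (P : 'I_n.+1 -> Prop) :
  P (lshift n (ord0 : 'I_1)) -> (forall j : 'I_n, P (rshift 1 j)) -> forall i, P i.
Proof.
move=> P0 P1 i; rewrite -[i](@splitK 1 n).
by case: (@fintype.split 1 n i) => [j|j] //=; rewrite (ord1 j).
Qed.

Lemma ucs_slice M n (f : 'rV[R]_n.+1 -> R) a : ucs M f -> ucs M (slice f a).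
Proof.
move=> [uf f0]; split=> [e /uf[d d0 df]|x i Mx].
- exists d => // x y xy; apply: df; apply: ord_consP => [|j].
  + by rewrite !row_consl subrr normr0.
  + by rewrite !row_consr.
- by apply: (f0 _ (rshift 1 i)); rewrite row_consr.
Qed.

Lemma slice0 M n (f : 'rV[R]_n.+1 -> R) a : ucs M f -> M <= `|a| -> slice f a = cst 0.
Proof.
by move=> [_ f0] Ma; apply/funext => y; apply: (f0 _ (lshift n (ord0 : 'I_1))); rewrite row_consl.
Qed.

Section Basic.
Variable M : R.
Hypothesis M0 : 0 <= M.

Let lin n := forall c (f g : 'rV[R]_n -> R), ucs M f -> ucs M g ->
  rv_Rint (fun x => c * f x + g x) = c * rv_Rint f + rv_Rint g.
Let bnd n := forall (f : 'rV[R]_n -> R) e, 0 <= e -> ucs M f -> (forall x, `|f x| <= e) ->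
  `|rv_Rint f| <= e * (2 * M) ^+ n.

(** By linearity the difference of two slice integrals is the integral of the difference of the
    slices; that difference is uniformly small for nearby slices, and the bound in dimension [n]
    makes its integral small. *)
Let slice_int n (f : 'rV[R]_n.+1 -> R) : lin n -> bnd n -> ucs M f ->
  continuous (fun a => rv_Rint (slice f a)) /\
  (forall a, M <= `|a| -> rv_Rint (slice f a) = 0).
Proof.
move=> ln bn uf; split => [a|a Ma]; last first.
  have us := ucs_slice a uf; apply/eqP; rewrite -normr_le0.
  rewrite -(mul0r ((2 * M) ^+ n)); apply: bn => // x.
  by rewrite (slice0 uf Ma) normr0.
apply/cvgrPdist_lt => e e0.
(* Adding 1 keeps the divisor positive when [M] is 0, and later makes the estimate strict. *)
have K0 : 0 < (2 * M) ^+ n + 1 by rewrite ltr_wpDl// exprn_ge0// mulr_ge0.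
have [|d d0 df] := uf.1 (e / ((2 * M) ^+ n + 1)); first by rewrite divr_gt0.
near=> b.
have ab : `|a - b| < d by near: b; apply: cvgr_dist_lt.
have -> : rv_Rint (slice f a) - rv_Rint (slice f b) =
    rv_Rint (fun x => -1 * slice f b x + slice f a x).
  by rewrite ln; [ring|exact: ucs_slice|exact: ucs_slice].
apply: (@le_lt_trans _ _ (e / ((2 * M) ^+ n + 1) * (2 * M) ^+ n)).
  apply: bn; first by rewrite divr_ge0// ltW.
  - by apply: ucs_lin; exact: ucs_slice.
  - move=> x; rewrite mulN1r addrC ltW//; apply: df; apply: ord_consP => [|j].
    + by rewrite !row_consl.
    + by rewrite !row_consr subrr normr0.
by rewrite mulrAC ltr_pdivrMr// ltr_pM2l// ltrDl.
Unshelve. all: by end_near. Qed.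

(** A joint induction: integrability of the slice integrals in dimension [n.+1] rests on both
    properties in dimension [n]. *)
Let lin_bnd n : lin n /\ bnd n.
Proof.
elim: n => [|n [ln bn]].
  by split=> // f e e0 _ fe; rewrite expr0 mulr1; exact: fe.
split=> [c f g uf ug|f e e0 uf fe] /=.
- have [cf f0] := slice_int ln bn uf; have [cg g0] := slice_int ln bn ug.
  have i1 := integrable_compact_support cf f0.
  have i2 := integrable_compact_support cg g0.
  rewrite -RintegralZl// -RintegralD//; last first.
    apply: (@integrable_compact_support _ M) => [x|a /f0 ->]; last by rewrite mulr0.
    by apply: cvgM; [exact: cvg_cst|exact: cf].
  by apply: eq_Rintegral => a _; rewrite -ln//; exact: ucs_slice.
- have [cf f0] := slice_int ln bn uf.
  rewrite exprSr [leRHS]mulrA; apply: (@norm_Rintegral_le _ M _ (fun a => rv_Rint (slice f a))) => //.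
    by rewrite mulr_ge0// exprn_ge0// mulr_ge0.
  move=> a; apply: bn => //; first exact: ucs_slice.
  by move=> x; exact: fe.
Qed.

Lemma rv_Rint_lin n c (f g : 'rV[R]_n -> R) : ucs M f -> ucs M g ->
  rv_Rint (fun x => c * f x + g x) = c * rv_Rint f + rv_Rint g.
Proof. exact: (lin_bnd n).1. Qed.

Lemma norm_rv_Rint_le n (f : 'rV[R]_n -> R) e :
  0 <= e -> ucs M f -> (forall x, `|f x| <= e) ->
  `|rv_Rint f| <= e * (2 * M) ^+ n.
Proof. exact: (lin_bnd n).2. Qed.

Lemma continuous_rv_Rint_slice n (f : 'rV[R]_n.+1 -> R) : ucs M f ->
  continuous (fun a => rv_Rint (slice f a)).
Proof. by move=> /(slice_int (lin_bnd n).1 (lin_bnd n).2)[]. Qed.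

Lemma rv_Rint_slice0 n (f : 'rV[R]_n.+1 -> R) a : ucs M f -> M <= `|a| ->
  rv_Rint (slice f a) = 0.
Proof. by move=> /(slice_int (lin_bnd n).1 (lin_bnd n).2)[_]; exact. Qed.

Lemma integrable_rv_Rint_slice n (f : 'rV[R]_n.+1 -> R) : ucs M f ->
  mu.-integrable setT (fun a => (rv_Rint (slice f a))%:E).
Proof.
move=> uf; apply: (@integrable_compact_support _ M).
- exact: continuous_rv_Rint_slice.
- by move=> a; exact: rv_Rint_slice0.
Qed.

Lemma rv_int_EFin n (f : 'rV[R]_n -> R) : ucs M f ->
  rv_int (fun x => (f x)%:E) = (rv_Rint f)%:E.
Proof.
elim: n f => [//|n IH] f uf /=.
rewrite /Rintegral fineK; last exact: (integrable_fin_num _ (integrable_rv_Rint_slice uf)).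
by apply: eq_integral => a _; rewrite -IH//; exact: ucs_slice.
Qed.

Lemma le_rv_Rint n (f g : 'rV[R]_n -> R) : ucs M f -> ucs M g ->
  (forall x, f x <= g x) -> rv_Rint f <= rv_Rint g.
Proof.
elim: n f g => [|n IH] f g uf ug fg /=; first exact: fg.
apply: le_Rintegral => //; [exact: integrable_rv_Rint_slice..|].
by move=> a _; apply: IH => [||x]; [exact: ucs_slice..|exact: fg].
Qed.

(** A shift of the first coordinate acts on the outermost integral, where the one-dimensional result
    applies; any other shift acts inside each slice, by induction. *)
Lemma rv_Rint_translation n (f : 'rV[R]_n -> R) k h : ucs M f ->
  rv_Rint (fun x => f (h *: delta_mx 0 k + x)) = rv_Rint f.
Proof.
elim: n f k => [f []//|n IH] f k uf /=.
elim/ord_consP: k => [|j].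
- have := @Rintegral_translation _ M h _ (continuous_rv_Rint_slice uf)
    (fun a => @rv_Rint_slice0 _ f a uf).
  move=> <-; apply: eq_Rintegral => a _; congr rv_Rint; apply/funext => y.
  congr f; apply/rowP; apply: ord_consP => [|l]; rewrite mxE.
    by rewrite !row_consl !mxE !eqxx mulr1 addrC.
  by rewrite !row_consr !mxE -val_eqE/= mulr0 add0r.
- apply: eq_Rintegral => a _; rewrite -(IH (slice f a) j); last exact: ucs_slice.
  congr rv_Rint; apply/funext => y.
  congr f; apply/rowP; apply: ord_consP => [|l]; rewrite mxE.
    by rewrite !row_consl !mxE -val_eqE/= mulr0 add0r.
  by rewrite !row_consr !mxE -!val_eqE/=.
Qed.

End Basic.

Lemma is_derive_line (V : normedModType R) (f : V -> R) (x v : V) (s df : R) :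
  is_derive (s *: v + x) v f df ->
  is_derive s (1 : R) (fun r : R => f (r *: v + x)) df.
Proof.
move=> [fd <-].
have E : (fun h : R => h^-1 *: (((fun r : R => f (r *: v + x)) \o shift s) (h *: (1 : R))
    - f (s *: v + x))) =
  (fun h : R => h^-1 *: ((f \o shift (s *: v + x)) (h *: v) - f (s *: v + x))).
  by apply/funext => h /=; rewrite [h%:A]mulr1 scalerDl addrA.
by split; rewrite /derivable /derive E.
Qed.

(** The difference quotient has integral 0 by translation invariance. By the mean value theorem it
    equals [df] at a point at distance at most [h], so uniform continuity of [df] makes it uniformly
    close to [df]. *)
Lemma rv_Rint_derive0 M n (f df : 'rV[R]_n -> R) k : 0 <= M ->
  ucs M f -> ucs M df ->
  (forall x, is_derive x (delta_mx 0 k) f (df x)) -> rv_Rint df = 0.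
Proof.
move=> M0 uf udf fdf.
have N0 : 0 <= M + 1 by rewrite addr_ge0.
have MN : M <= M + 1 by rewrite lerDl.
apply/eqP; rewrite -normr_le0; apply/ler_addgt0Pl => e e0; rewrite addr0.
pose K := (2 * (M + 1)) ^+ n + 1 : R.
have K0 : 0 < K by rewrite ltr_wpDl// exprn_ge0// mulr_ge0.
have [|d d0 dd] := udf.1 (e / K); first by rewrite divr_gt0.
(* Below [d] for the modulus of continuity of [df]; at most 1 so that the translate of [f] stays
   supported in the cube of half-side [M + 1]. *)
pose h := Num.min (d / 2) 1.
have h0 : 0 < h by rewrite lt_min divr_gt0 //=.
have h1 : h <= 1 by rewrite ge_min lexx orbT.
have hd : h < d by rewrite gt_min; apply/orP; left; lra.
pose v : 'rV[R]_n := delta_mx 0 k.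
have uT : ucs (M + 1) (fun x => f (h *: v + x)).
  split=> [r /(uf.1)[d' d'0 d'f]|x i Mx].
    by exists d' => // x y xy; apply: d'f => i; rewrite !mxE opprD addrACA subrr add0r.
  apply: (uf.2 _ i); rewrite !mxE.
  have : `|h * v 0 i| <= 1.
    rewrite !mxE; case: (_ && _); rewrite ?(mulr0, mulr1) ?normr0// ger0_norm//.
    exact: ltW.
  have := lerB_normD (x 0 i) (h * v 0 i); rewrite [x 0 i + _]addrC !mxE; lra.
have uf' := ucs_le MN uf; have udf' := ucs_le MN udf.
have uD : ucs (M + 1) (fun x => - 1 * f x + f (h *: v + x)) by exact: ucs_lin.
have D0 : rv_Rint (fun x => - 1 * f x + f (h *: v + x)) = 0.
  by rewrite (rv_Rint_lin N0)// (rv_Rint_translation N0)//; ring.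
(* Subtracting the difference quotient leaves the integral of [df] unchanged but makes the integrand
   uniformly small. *)
have <- : rv_Rint (fun x => - h^-1 * (- 1 * f x + f (h *: v + x)) + df x) = rv_Rint df.
  by rewrite (rv_Rint_lin N0)// D0 mulr0 add0r.
apply: (@le_trans _ _ (e / K * (2 * (M + 1)) ^+ n)); last first.
  by rewrite mulrAC ler_pdivrMr// ler_pM2l// lerDl.
apply: norm_rv_Rint_le => //; first by rewrite divr_ge0// ltW.
  exact: ucs_lin.
move=> x.
have gd s : is_derive s (1 : R) (fun r : R => f (r *: v + x)) (df (s *: v + x)).
  exact: is_derive_line.
have gc : {within `[0, h], continuous (fun r : R => f (r *: v + x))}.
  apply: continuous_subspaceT => s'.
  by apply/differentiable_continuous/derivable1_diffP; exact: ex_derive.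
have [s] := MVT h0 (fun s _ => gd s) gc.
rewrite in_itv/= => /andP[s0 sh]; rewrite scale0r add0r subr0 => fE.
have -> : - h^-1 * (- 1 * f x + f (h *: v + x)) + df x = df x - df (s *: v + x).
  rewrite -[f (h *: v + x)](subrK (f x)) fE; field; exact: lt0r_neq0.
apply/ltW/dd => i; rewrite !mxE opprD addrCA subrr addr0 normrN.
apply: le_lt_trans hd; case: (_ && _); rewrite ?(mulr0, mulr1) ?normr0//; last exact: ltW.
by rewrite ger0_norm ?ltW.
Qed.
End IteratedIntegral.

(** * Scalar products, the square root [S] of -B^2, and the smallest eigenvalue as minimum of the
    Rayleigh quotient *)

Section LinearAlgebra.
Variable R : realType.

Lemma cvg_sumr (T I : Type) (F : set_system T) {FF : Filter F} (r : seq I) (f : I -> T -> R)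
    (l : I -> R) : (forall i, f i x @[x --> F] --> l i) ->
  \sum_(i <- r) f i x @[x --> F] --> \sum_(i <- r) l i.
Proof.
move=> fl; elim: r => [|i r IH].
  by under eq_fun do rewrite big_nil; rewrite big_nil; exact: cvg_cst.
by under eq_fun do rewrite big_cons; rewrite big_cons; apply: cvgD.
Qed.

Definition sdot m (u v : 'rV[R]_m) : R := (u *m v^T) 0 0.

Lemma sdotE m (u v : 'rV[R]_m) : sdot u v = \sum_i u 0 i * v 0 i.
Proof. by rewrite /sdot mxE; apply: eq_bigr => i _; rewrite mxE. Qed.

Lemma sdotC m (u v : 'rV[R]_m) : sdot u v = sdot v u.
Proof. by rewrite !sdotE; apply: eq_bigr => i _; rewrite mulrC. Qed.

Lemma sdotDl m (u v w : 'rV[R]_m) : sdot (u + v) w = sdot u w + sdot v w.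
Proof. by rewrite /sdot mulmxDl mxE. Qed.

Lemma sdotZl m a (u v : 'rV[R]_m) : sdot (a *: u) v = a * sdot u v.
Proof. by rewrite /sdot -scalemxAl mxE. Qed.

Lemma sdotDr m (u v w : 'rV[R]_m) : sdot w (u + v) = sdot w u + sdot w v.
Proof. by rewrite ![sdot w _]sdotC sdotDl. Qed.

Lemma sdotZr m a (u v : 'rV[R]_m) : sdot u (a *: v) = a * sdot u v.
Proof. by rewrite ![sdot u _]sdotC sdotZl. Qed.

Lemma sdotM m (u v : 'rV[R]_m) (A : 'M[R]_m) : sdot (u *m A) v = sdot u (v *m A^T).
Proof. by rewrite /sdot trmx_mul trmxK mulmxA. Qed.

Lemma sdot_ge0 m (u : 'rV[R]_m) : 0 <= sdot u u.
Proof. by rewrite sdotE sumr_ge0// => i _; rewrite -expr2 sqr_ge0. Qed.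

Lemma sdot_eq0 m (u : 'rV[R]_m) : (sdot u u == 0) = (u == 0).
Proof.
apply/idP/eqP => [|->]; last by rewrite /sdot mul0mx mxE eqxx.
rewrite sdotE psumr_eq0; last by move=> i _; rewrite -expr2 sqr_ge0.
move=> /allP u0; apply/rowP => i; rewrite mxE; apply/eqP.
by have := u0 i (mem_index_enum i); rewrite /= mulf_eq0 orbb.
Qed.

Section Skew.
Variables (m : nat) (B S : 'M[R]_m).
Hypothesis HBskew : B^T = - B.
Hypothesis HSsym : S^T = S.
Hypothesis HSpd : forall v : 'rV[R]_m, v != 0 -> 0 < (v *m S *m v^T) 0 0.
Hypothesis HSsq : S *m S = - (B *m B).

(* [T = SB - BS] is symmetric and anticommutes with the positive definite [S], whence [tr (T S T) = 0] and [T = 0]. *)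
Lemma sqrtm_comm : S *m B = B *m S.
Proof.
pose T := S *m B - B *m S.
have TT : T^T = T.
  by rewrite /T linearB/= !trmx_mul HBskew HSsym mulNmx mulmxN opprK addrC.
have ST : S *m T = - (T *m S).
  rewrite /T mulmxBr mulmxBl mulmxA HSsq -!mulmxA HSsq mulNmx mulmxN -!mulmxA.
  by rewrite opprB addrC.
have tr0 : \tr (T *m S *m T) = 0.
  have : \tr (T *m S *m T) = - \tr (T *m S *m T).
    have TS : T *m S = - (S *m T) by rewrite ST opprK.
    by rewrite [LHS]mxtrace_mulC [in LHS]TS mulmxN linearN/= mulmxA.
  by move=> /eqP; rewrite -addr_eq0 -mulr2n mulrn_eq0 => /eqP.
apply/eqP; rewrite -subr_eq0 -/T; apply/eqP/row_matrixP => i; rewrite row0.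
apply/eqP; rewrite -[_ == 0]negbK; apply/negP => Ti.
have rS j : 0 <= (T *m S *m T) j j.
  have -> : (T *m S *m T) j j = (row j T *m S *m (row j T)^T) 0 0.
    by rewrite -{2}TT tr_row -row_mul !mxE; apply: eq_bigr => k _; rewrite !mxE.
  by have [->|/HSpd/ltW//] := eqVneq (row j T) 0; rewrite mul0mx mul0mx mxE.
have : 0 < \tr (T *m S *m T).
  rewrite /mxtrace (bigD1 i)//= ltr_pwDl ?sumr_ge0//.
  have -> : (T *m S *m T) i i = (row i T *m S *m (row i T)^T) 0 0.
    by rewrite -{2}TT tr_row -row_mul !mxE; apply: eq_bigr => k _; rewrite !mxE.
  exact: HSpd.
by rewrite tr0 ltxx.
Qed.

Lemma posdef_unitmx : S \in unitmx.
Proof.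
rewrite -row_free_unit -kermx_eq0; apply/eqP/row_matrixP => i; rewrite row0.
apply/eqP; rewrite -[_ == 0]negbK; apply/negP => /HSpd.
by rewrite -row_mul mulmx_ker row0 mul0mx mxE ltxx.
Qed.

(* Rows [z *m Jmx] are the vectors [S^-1 B z]. *)
Definition Jmx : 'M[R]_m := - (B *m invmx S).

Let uS := posdef_unitmx.

Lemma Jmx_S : Jmx *m S = B^T.
Proof. by rewrite /Jmx mulNmx -mulmxA mulVmx// mulmx1 HBskew. Qed.

Let invS_comm : invmx S *m B = B *m invmx S.
Proof.
by rewrite -[LHS](mulmxK uS) -(mulmxA (invmx S)) -sqrtm_comm mulKmx.
Qed.

(** Moving [B] past [invmx S] leaves -B^2 S^-1, which is [S]; this turns <J z, B z> into <z, S
    z>. *)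
Lemma Jmx_B : Jmx *m B = S.
Proof.
by rewrite /Jmx mulNmx -mulmxA invS_comm mulmxA -mulNmx -HSsq mulmxK.
Qed.

(** Since [B] commutes with [invmx S], the matrix [Jmx] is skew-symmetric. The trace is what J
    contributes to the divergence. *)
Lemma tr_Jmx : \tr Jmx = 0.
Proof.
have : \tr Jmx = - \tr Jmx.
  have JT : Jmx^T = - Jmx.
    by rewrite /Jmx linearN/= trmx_mul HBskew mulmxN trmx_inv HSsym invS_comm.
  by rewrite -[LHS]mxtrace_tr JT linearN.
by move=> /eqP; rewrite -addr_eq0 -mulr2n mulrn_eq0 => /eqP.
Qed.

Lemma sdot_skew z : sdot z (z *m B^T) = 0.
Proof.
have : sdot z (z *m B^T) = - sdot z (z *m B^T).
  rewrite -[in LHS]sdotM sdotC HBskew mulmxN -[- (z *m B)]scaleN1r sdotZr; ring.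
by move=> /eqP; rewrite -addr_eq0 -mulr2n mulrn_eq0 => /eqP.
Qed.

Lemma sdot_Jmx_B z : sdot (z *m Jmx) (z *m B^T) = sdot (z *m S) z.
Proof. by rewrite -sdotM -mulmxA Jmx_B. Qed.

(** For the inner product defined by [S], J z is orthogonal to z and, by the next lemma, has the
    same length; so the [S]-length of a combination of z and J z is Pythagorean. *)
Lemma sdot_Jmx_S z : sdot (z *m Jmx *m S) z = 0.
Proof. by rewrite -mulmxA Jmx_S sdotC sdot_skew. Qed.

Lemma sdot_Jmx_S_Jmx z : sdot (z *m Jmx *m S) (z *m Jmx) = sdot (z *m S) z.
Proof. by rewrite -(mulmxA z) Jmx_S sdotC sdot_Jmx_B. Qed.

Lemma sdot_Ssym u v : sdot (u *m S) v = sdot (v *m S) u.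
Proof. by rewrite sdotM HSsym sdotC. Qed.

Lemma sdot_S_ge0 z : 0 <= sdot (z *m S) z.
Proof.
by have [->|/HSpd/ltW//] := eqVneq z 0; rewrite /sdot !mul0mx mxE.
Qed.

Lemma sdot_S_eq0 z : (sdot (z *m S) z == 0) = (z == 0).
Proof.
by have [->|/HSpd/lt0r_neq0/negPf//] := eqVneq z 0; rewrite /sdot !mul0mx mxE eqxx.
Qed.

Lemma continuous_sdot_S : continuous (fun z : 'rV[R]_m => sdot (z *m S) z).
Proof.
have -> : (fun z => sdot (z *m S) z) = fun z => \sum_i \sum_j z 0 j * S j i * z 0 i.
  by apply/funext => z; rewrite sdotE; apply: eq_bigr => i _; rewrite mxE mulr_suml.
move=> z; do 2 (apply: (cvg_sumr (F := nbhs z)) => ?).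
apply: cvgM; last exact: coord_continuous.
by apply: cvgM; [exact: coord_continuous|exact: cvg_cst].
Qed.

End Skew.

Lemma continuous_sdot m : continuous (fun z : 'rV[R]_m => sdot z z).
Proof.
have -> : (fun z : 'rV[R]_m => sdot z z) = fun z => sdot (z *m 1%:M) z.
  by apply/funext => z; rewrite mulmx1.
exact: continuous_sdot_S.
Qed.

(** The quadratic form attains its minimum [mu] on the compact unit sphere. A minimiser is an
    eigenvector for [mu], by a first-order variation, hence [lam <= mu]. *)
Lemma Rayleigh_min m (S : 'M[R]_m) (lam : R) : S^T = S ->
  (forall mu, eigenvalue S mu -> lam <= mu) ->
  forall v, lam * sdot v v <= sdot (v *m S) v.
Proof.
move=> Ssym lammin.
pose K := [set v : 'rV[R]_m | sdot v v = 1].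
have q_cont : continuous (fun v : 'rV[R]_m => sdot (v *m S) v) by exact: continuous_sdot_S.
have normalize (v : 'rV[R]_m) : v != 0 -> sdot ((Num.sqrt (sdot v v))^-1 *: v) ((Num.sqrt (sdot v v))^-1 *: v) = 1.
  move=> v0; have s0 : sdot v v != 0 by rewrite sdot_eq0.
  rewrite sdotZl sdotZr mulrA -invfM -expr2 sqr_sqrtr ?sdot_ge0//.
  by rewrite mulVf.
(* In dimension zero the unit sphere is empty, and the claim reads 0 <= 0. *)
have [[v0 v0n0]|Z] := pselect (exists v : 'rV[R]_m, v != 0); last first.
  move=> v; have -> : v = 0 by apply: contrapT => /eqP vn0; apply: Z; exists v.
  by rewrite /sdot !mul0mx mxE mulr0.
have K0 : K !=set0 by exists ((Num.sqrt (sdot v0 v0))^-1 *: v0); exact: normalize.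
have cK : compact K.
  apply: bounded_closed_compact.
    exists 1; split; first exact: num_real.
    move=> M M1 v Kv; rewrite /Num.norm/= mx_normrE; apply: bigmax_le => [|[i j] _]/=.
      by rewrite ltW// (lt_trans ltr01).
    rewrite (ord1 i); apply: (le_trans _ (ltW M1)).
    have : (v 0 j) ^+ 2 <= 1.
      rewrite -Kv sdotE (bigD1 j)//= expr2 lerDl sumr_ge0// => k _.
      by rewrite -expr2 sqr_ge0.
    by rewrite -real_normK ?num_real// expr_le1.
  apply: (closed_comp (f := fun v : 'rV[R]_m => sdot v v) (D := [set 1])).
    by move=> v _; exact: continuous_sdot.
  exact: closed_eq.
have [v Kv vmin] := EVT_min_rV K0 cK (continuous_subspaceT q_cont).
rewrite inE /K/= in Kv.
pose mu := sdot (v *m S) v.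
have muS w : mu * sdot w w <= sdot (w *m S) w.
  have [->|w0] := eqVneq w 0; first by rewrite /sdot !mul0mx mxE mulr0.
  have := vmin _ (mem_set (normalize w w0)).
  have s0 : 0 < sdot w w by rewrite lt_neqAle sdot_ge0 eq_sym sdot_eq0 w0.
  rewrite -scalemxAl sdotZl sdotZr mulrA -invfM -expr2 sqr_sqrtr ?sdot_ge0//.
  by rewrite mulrC ler_pdivlMr.
move=> u; apply: le_trans (muS u); rewrite ler_wpM2r ?sdot_ge0//; apply: lammin.
apply/eigenvalueP; exists v; last first.
  by apply/eqP => v00; move: Kv; rewrite v00 /sdot mul0mx mxE => /eqP; rewrite eq_sym oner_eq0.
apply/eqP; rewrite -subr_eq0 -sdot_eq0.
have [w wE] : {w | w = v *m S - mu *: v} by eexists.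
rewrite -wE.
(* Minimality tested at v - t w, where w is the defect of the eigenvalue equation: the linear term
   in [t] forces w = 0. *)
have E t : 0 <= - 2 * t * sdot w w + t ^+ 2 * (sdot (w *m S) w - mu * sdot w w).
  have := muS (v - t *: w); rewrite -subr_ge0; congr (0 <= _).
  have E0 : sdot w w = sdot (v *m S) w - mu * sdot v w.
    by rewrite {1}wE sdotDl -scaleNr sdotZl mulNr.
  rewrite mulmxBl -scalemxAl -?[- (t *: _)]scaleNr !(sdotDl, sdotDr, sdotZl, sdotZr).
  rewrite (sdotC w v) (sdot_Ssym Ssym w v) -/mu Kv [X in _ = - 2 * t * X + _]E0; ring.
set n := sdot w w in E *.
set q := sdot (w *m S) w - mu * n in E.
have q0 : 0 <= q by rewrite subr_ge0 muS.
have n0 : 0 <= n by exact: sdot_ge0.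
rewrite eq_le n0 andbT.
have [//|np] := leP n 0.
have q1 : 0 < q + 1 by rewrite ltr_wpDl.
(* For this [t] the quadratic equals - t^2 (q + 2), negative unless [n] vanishes; [q + 1] avoids
   dividing by a possibly zero [q]. *)
have := E (n / (q + 1)).
have -> : - 2 * (n / (q + 1)) * n + (n / (q + 1)) ^+ 2 * q = - (n / (q + 1)) ^+ 2 * (q + 2).
  by field; exact: lt0r_neq0.
have : 0 < (n / (q + 1)) ^+ 2 by rewrite exprn_gt0// divr_gt0.
nra.
Qed.

End LinearAlgebra.

(** * Directional derivatives, real powers, and continuity across the origin *)

Section Calculus.
Variable R : realType.

Lemma mx_norm_lt n (x : 'rV[R]_n) (d : R) : 0 < d ->
  (forall i, `|x 0 i| < d) -> `|x| < d.
Proof.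
move=> d0 xd; rewrite /Num.norm/= mx_normrE; apply: bigmax_lt => //.
by move=> [i j] _ /=; rewrite (ord1 i).
Qed.

(** Heine's theorem on the cube of half-side [M + 1]. With a modulus below 1, a point outside this
    cube and its neighbours all lie where [f] vanishes. *)
Lemma continuous_ucs n M (f : 'rV[R]_n -> R) : continuous f ->
  (forall (x : 'rV[R]_n) i, M <= `|x 0 i| -> f x = 0) -> ucs M f.
Proof.
move=> fc f0; split => // e e0.
pose K := [set v : 'rV[R]_n | forall i, v 0 i \in `[- (M + 1), M + 1]].
have cK : compact K.
  apply: (@rV_compact _ _ (fun=> `[- (M + 1), M + 1]%classic)) => _.
  exact: segment_compact.
have : \forall d \near (0 : R)^'+, K `<=` [set x : 'rV[R]_n | forall y : 'rV[R]_n,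
    (forall i, `|x 0 i - y 0 i| < d) -> `|f x - f y| < e].
  have /compact_near_coveringP ncK := cK.
  apply: (ncK R ((0 : R)^'+) (fun d (x : 'rV[R]_n) => forall y : 'rV[R]_n,
    (forall i, `|x 0 i - y 0 i| < d) -> `|f x - f y| < e) _) => x _.
  have /nbhs_ballP[r /= r0 fr] : \forall y \near x, `|f x - f y| < e / 2.
    by have /cvgrPdist_lt := fc x; apply; rewrite divr_gt0.
  near=> x' d => y xy.
  have dr : d < r / 2 by near: d; apply: nbhs_right_lt; rewrite divr_gt0.
  have d0 : 0 < d by near: d; exact: nbhs_right_gt.
  have bx' : ball x (r / 2) x' by near: x'; apply: nbhsx_ballx; rewrite divr_gt0.
  have h1 : `|f x - f x'| < e / 2.
    by apply: fr; apply: le_ball bx'; rewrite ler_pdivrMr// ler_pMr// ler1n.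
  have h2 : `|f x - f y| < e / 2.
    apply: fr; rewrite [r]splitr; apply: (ball_triangle bx').
    rewrite -ball_normE /ball_/=; apply: lt_trans dr.
    by apply: mx_norm_lt => // i; rewrite !mxE.
  have -> : f x' - f y = (f x - f y) - (f x - f x') by ring.
  apply: (le_lt_trans (ler_normB _ _)); lra.
move=> K_near.
have [d [d0 [d1 dK]]] : exists d : R, 0 < d /\ d < 1 /\ K `<=` [set x : 'rV[R]_n | forall y : 'rV[R]_n,
    (forall i, `|x 0 i - y 0 i| < d) -> `|f x - f y| < e].
  near (0 : R)^'+ => d; exists d; split; first by near: d; exact: nbhs_right_gt.
  split; first by near: d; exact: nbhs_right_lt.
  by near: d.
exists d => // x y xy; have [|nK] := pselect (K x); first by move=> /dK; apply.
have [i xi] : exists i, M + 1 < `|x 0 i|.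
  apply: contrapT => /forallNP xi; apply: nK => i.
  by rewrite in_itv/= -ler_norml leNgt; apply/negP/xi.
have xi0 : f x = 0 by apply: (f0 _ i); rewrite ltW// (lt_trans _ xi)// ltrDl.
have yi0 : f y = 0.
  apply: (f0 _ i); have := xy i; have := lerB_normD (x 0 i) (y 0 i - x 0 i).
  rewrite (addrC (x 0 i)) subrK [`|y 0 i - _|]distrC; lra.
by rewrite xi0 yi0 subrr normr0.
Unshelve. all: by end_near. Qed.

(** Restriction to the line through [x] in direction [v] reduces this to the one-variable chain
    rule. *)
Lemma is_derive_compR (V : normedModType R) (f : V -> R) (g : R -> R) x v df dg :
  is_derive x v f df -> is_derive (f x) (1 : R) g dg ->
  is_derive x v (fun y => g (f y)) (df * dg).
Proof.
move=> fd gd.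
have E : forall f : V -> R, (fun h : R => h^-1 *: (((fun h : R => f (h *: v + x)) \o shift 0) (h *: (1 : R))
    - f (0 *: v + x))) =
  (fun h : R => h^-1 *: ((f \o shift x) (h *: v) - f x)).
  by move=> f'; apply/funext => h /=; rewrite [h%:A]mulr1 addr0 scale0r add0r.
have fl : is_derive (0 : R) (1 : R) (fun h : R => f (h *: v + x)) df.
  by apply: is_derive_line; rewrite scale0r add0r.
have gl : is_derive (f (0 *: v + x)) (1 : R) g dg by rewrite scale0r add0r.
have [] := is_derive1_comp gl fl.
rewrite /derivable /derive (E (g \o f)) => d1 d2.
by split; [exact: d1|rewrite mulrC -d2].
Qed.

(** Coordinates and [psi] are polynomials of degree at most 2 along lines, so their derivatives can
    be read off from an expansion. *)
Lemma is_derive_quadratic (V : normedModType R) (f : V -> R) x v a b :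
  (forall h, f (h *: v + x) = f x + h * a + h ^+ 2 * b) -> is_derive x v f a.
Proof.
move=> fE.
have L : (fun h : R => h^-1 *: ((f \o shift x) (h *: v) - f x)) @ 0^' --> a.
  apply: (@cvg_trans _ ((fun h : R => a + h * b) @ 0^')).
    apply: near_eq_cvg; near=> h; have h0 : h != 0 by near: h; exact: nbhs_dnbhs_neq.
    by rewrite /= fE /GRing.scale/=; field.
  have : (fun h : R => a + h * b) @ 0^' --> a + 0 * b.
    apply: cvgD; first exact: cvg_cst.
    by apply: cvgM; [move=> P; exact: nbhs_dnbhs|exact: cvg_cst].
  by rewrite mul0r addr0.
by split; [apply/cvg_ex; exists a|apply/cvg_lim].
Unshelve. all: by end_near. Qed.

Lemma is_derive_powR (V : normedModType R) (f : V -> R) (c : R) x v df :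
  0 < f x -> is_derive x v f df ->
  is_derive x v (fun y => f y `^ c) (df * (c * f x `^ (c - 1))).
Proof.
move=> fx fd; apply: (@is_derive_compR _ f (fun y => y `^ c)).
exact: is_derive1_powR.
Qed.

Lemma continuous_powR (T : topologicalType) (f : T -> R) (c : R) x :
  {for x, continuous f} -> 0 < f x -> {for x, continuous (fun y => f y `^ c)}.
Proof.
move=> fc fx; apply: (cvg_comp f (fun y => y `^ c) fc).
have : {for f x, continuous (fun y : R => y `^ c)}.
  apply/differentiable_continuous/derivable1_diffP.
  by apply: ex_derive; exact: is_derive1_powR.
exact.
Qed.

(** The power rule applies on each side of 0. At 0 the difference quotient is at most |h| in
    absolute value, because |h|^p <= |h|^2 for |h| < 1. *)
Lemma is_derive_norm_powR (p s : R) : 2 <= p ->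
  is_derive s (1 : R) (fun r => `|r| `^ p) (p * s * `|s| `^ (p - 2)).
Proof.
move=> p2; have [s0|s0|->] := ltgtP s 0.
- apply: (@near_eq_is_derive _ _ _ (fun r => (- r) `^ p)).
    by near=> r; rewrite ltr0_norm//; near: r; exact: lt_nbhsl.
  rewrite ltr0_norm//.
  have -> : p * s * (- s) `^ (p - 2) = - 1 * (p * (- s) `^ (p - 1)).
    rewrite -[in RHS](@mulr_powRB1 _ (- s) (p - 1)) ?oppr_ge0 ?ltW//; last lra.
    have -> : p - 1 - 1 = p - 2 by ring.
    by ring.
  by apply: is_derive_powR; rewrite oppr_gt0.
- apply: (@near_eq_is_derive _ _ _ (fun r => r `^ p)).
    by near=> r; rewrite gtr0_norm//; near: r; exact: lt_nbhsr.
  rewrite gtr0_norm//.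
  have -> : p * s * s `^ (p - 2) = 1 * (p * s `^ (p - 1)).
    rewrite -[in RHS](@mulr_powRB1 _ s (p - 1)) ?ltW//; last lra.
    have -> : p - 1 - 1 = p - 2 by ring.
    by ring.
  exact: is_derive_powR.
- rewrite mulr0 mul0r.
  have L : (fun h : R => h^-1 *: (((fun r => `|r| `^ p) \o shift 0) (h *: (1 : R)) - `|0 : R| `^ p)) @ 0^' --> (0 : R).
    apply/cvgr0Pnorm_lt => e e0; near=> h.
    have h0 : h != 0 by near: h; exact: nbhs_dnbhs_neq.
    rewrite /= addr0 normr0 powR0; last by lra.
    rewrite subr0 [h%:A]mulr1 normrZ normfV.
    have h1 : `|h| < 1 by near: h; apply: dnbhs0_lt.
    have he : `|h| < e by near: h; apply: dnbhs0_lt.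
    have hp : 0 < `|h| by rewrite normr_gt0.
    rewrite (ger0_norm (powR_ge0 _ _)) mulrC ltr_pdivrMr//.
    apply: (@le_lt_trans _ _ (`|h| `^ 2%:R)).
      by apply: ger_powR => //; rewrite hp ltW.
    by rewrite powR_mulrn// expr2 ltr_pM2r.
  by split; [apply/cvg_ex; exists 0|apply/cvg_lim].
Unshelve. all: by end_near. Qed.

(** Near 0 the factor |s|^(p - 2) is only bounded by 1, since it is constantly 1 when [p] is 2; the
    factor [s] gives the limit. *)
Lemma continuous_norm_powR_derive (p : R) : 2 <= p ->
  continuous (fun s => p * s * `|s| `^ (p - 2)).
Proof.
move=> p2 s; have [->|s0] := eqVneq s 0; last first.
  apply: cvgM; first by apply: cvgM; [exact: cvg_cst|exact: cvg_id].
  apply: continuous_powR; last by rewrite normr_gt0.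
  exact: norm_continuous.
rewrite /prop_for /continuous_at mulr0 mul0r.
have p0 : 0 < p by lra.
apply/cvgr0Pnorm_lt => e e0; near=> h.
have h1 : `|h| < 1 by near: h; apply: (@nbhs0_lt R R).
have he : `|h| < e / p by near: h; apply: (@nbhs0_lt R R); rewrite divr_gt0.
rewrite !normrM (gtr0_norm p0).
apply: (@le_lt_trans _ _ (p * `|h|)); last by rewrite mulrC -ltr_pdivlMr.
rewrite ler_piMr//; first by rewrite mulr_ge0// ltW.
rewrite (ger0_norm (powR_ge0 _ _)) [leRHS](_ : 1 = 1 `^ (p - 2)); last by rewrite powR1.
by apply: ge0_ler_powR; rewrite ?subr_ge0 ?nnegrE// ltW.
Unshelve. all: by end_near. Qed.

(** A singularity of [g] at the origin is harmless because [f] vanishes around it; [g] will be a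
    power of the gauge or a field component. *)
Lemma continuous_mul_off0 (V : normedModType R) (f g : V -> R) :
  continuous f -> (\forall x \near 0, f x = 0) ->
  (forall x, x != 0 -> {for x, continuous g}) -> continuous (fun x => f x * g x).
Proof.
move=> fc f0 gc x; have [->|x0] := eqVneq x 0; last by apply: cvgM; [exact: fc|exact: gc].
rewrite /continuous_at (nbhs_singleton f0) mul0r.
apply: (@cvg_trans _ ((fun=> 0) @ (0 : V))); last exact: cvg_cst.
by apply: near_eq_cvg; near=> y; rewrite (near f0 y)// mul0r.
Unshelve. all: by end_near. Qed.

End Calculus.

(** * Derivation and continuity rules for real-valued functions, in pointwise form *)

Section Rules.
Variables (R : realType) (V : normedModType R).
Implicit Types (f g : V -> R) (x v : V).

Lemma is_derive_mulR f g x v df dg : is_derive x v f df -> is_derive x v g dg ->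
  is_derive x v (fun y => f y * g y) (df * g x + f x * dg).
Proof.
move=> fd gd; have := is_deriveM fd gd.
by rewrite /GRing.scale/= addrC [g x * _]mulrC.
Qed.

Lemma is_derive_addR f g x v df dg : is_derive x v f df -> is_derive x v g dg ->
  is_derive x v (fun y => f y + g y) (df + dg).
Proof. exact: is_deriveD. Qed.

Lemma is_derive_cmulR c f x v df : is_derive x v f df ->
  is_derive x v (fun y => c * f y) (c * df).
Proof. exact: is_deriveZ. Qed.

End Rules.

Section ContinuousRules.
Variables (R : realType) (T : topologicalType) (x : T).
Implicit Types f g : T -> R.

Lemma continuous_mulR f g : {for x, continuous f} -> {for x, continuous g} ->
  f y * g y @[y --> x] --> f x * g x.
Proof. by move=> fc gc; apply: (cvgM (F := nbhs x)). Qed.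

Lemma continuous_addR f g : {for x, continuous f} -> {for x, continuous g} ->
  f y + g y @[y --> x] --> f x + g x.
Proof. by move=> fc gc; apply: (cvgD (F := nbhs x)). Qed.

Lemma continuous_cmulR c f : {for x, continuous f} ->
  c * f y @[y --> x] --> c * f x.
Proof. by move=> fc; apply: continuous_mulR => //; exact: cvg_cst. Qed.

Lemma continuous_exprR n f : {for x, continuous f} ->
  f y ^+ n @[y --> x] --> f x ^+ n.
Proof.
move=> fc; elim: n => [|n IH]; first exact: cvg_cst.
have -> : (fun y => f y ^+ n.+1) = fun y => f y * f y ^+ n.
  by apply/funext => y; rewrite exprS.
by rewrite exprS; apply: continuous_mulR.
Qed.

Lemma continuous_sumR (I : Type) (r : seq I) (f : I -> T -> R) :
  (forall i, {for x, continuous (f i)}) ->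
  \sum_(i <- r) f i y @[y --> x] --> \sum_(i <- r) f i x.
Proof. by move=> fc; apply: (cvg_sumr (F := nbhs x)). Qed.

End ContinuousRules.

(** * Test functions supported away from the origin, and integration of divergences against them *)

Section TestFunctions.
Variables (R : realType) (n : nat).

Lemma test_fun_support (K : set 'rV[R]_n) (u : 'rV[R]_n -> R) :
  compact K -> (forall x, ~ K x -> u x = 0) ->
  (exists2 M : R, 0 <= M & forall (x : 'rV[R]_n) i, M <= `|x 0 i| -> ~ K x) /\
  (forall x, ~ K x -> \forall y \near x, ~ K y) /\
  (forall x v, ~ K x -> 'D_v u x = 0).
Proof.
move=> cK u0; have cl : closed K := compact_closed (@norm_hausdorff _ _) cK.
have nK x : ~ K x -> \forall y \near x, ~ K y.
  by move=> Kx; apply: (open_nbhs_nbhs (conj (closed_openC cl) Kx)).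
split; last split=> // x v Kx.
- have [M [_ /(_ (`|M| + 1)) KM]] := compact_bounded cK.
  exists (`|M| + 2); first by rewrite addr_ge0.
  move=> x i Mx Kx; have : M < `|M| + 1 by rewrite (le_lt_trans (ler_norm M))// ltrDl.
  move=> /KM /(_ _ Kx); apply/negP; rewrite -ltNge.
  apply: (@lt_le_trans _ _ `|x 0 i|); first by apply: lt_le_trans Mx; lra.
  have /mapP[j Hj ->] : `|x 0 i| \in [seq `|x k.1 k.2| | k : 'I_1 * 'I_n].
    by apply/mapP; exists (0, i) => //=; rewrite mem_enum.
  by rewrite [leRHS]/Num.norm/= mx_normrE; apply/bigmax_geP; right => /=; exists j.
- rewrite (near_eq_derive (g := cst 0) v); first by rewrite derive_cst.
  by near=> y; apply: u0; near: y; exact: nK.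
Unshelve. all: by end_near. Qed.

Variables (p : R) (u : 'rV[R]_n -> R) (K : set 'rV[R]_n) (M : R).
Hypothesis p2 : 2 <= p.
Hypothesis usm : smooth u.
Hypothesis M0 : 0 <= M.
Hypothesis KM : forall (x : 'rV[R]_n) i, M <= `|x 0 i| -> ~ K x.
Hypothesis uK : forall x, ~ K x -> u x = 0.
Hypothesis duK : forall x v, ~ K x -> 'D_v u x = 0.
Hypothesis K0 : \forall x \near (0 : 'rV[R]_n), ~ K x.

Lemma continuous_test_fun : continuous u.
Proof. by move=> x; apply: differentiable_continuous; exact: (usm [::]). Qed.

Lemma continuous_derive_test_fun k : continuous ('D_(delta_mx 0 k) u).
Proof. by move=> x; apply: differentiable_continuous; exact: (usm [:: k]). Qed.

Lemma is_derive_test_fun k x :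
  is_derive x (delta_mx 0 k) u ('D_(delta_mx 0 k) u x).
Proof. by apply: derivableP; apply: diff_derivable; exact: (usm [::]). Qed.

Lemma is_derive_powR_test_fun k x :
  is_derive x (delta_mx 0 k) (fun y => `|u y| `^ p)
    ('D_(delta_mx 0 k) u x * (p * u x * `|u x| `^ (p - 2))).
Proof.
apply: (@is_derive_compR _ _ u (fun s => `|s| `^ p)); first exact: is_derive_test_fun.
exact: is_derive_norm_powR.
Qed.

Lemma continuous_normR_powR : continuous (fun s : R => `|s| `^ p).
Proof.
move=> s; apply/differentiable_continuous/derivable1_diffP.
by apply: ex_derive; exact: is_derive_norm_powR.
Qed.

Lemma continuous_powR_test_fun : continuous (fun y => `|u y| `^ p).
Proof.
move=> x; apply: (cvg_comp u (fun s => `|s| `^ p) (@continuous_test_fun x)).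
exact: continuous_normR_powR.
Qed.

Lemma ucs_mul_off0 (f g : 'rV[R]_n -> R) : continuous f ->
  (forall x, ~ K x -> f x = 0) ->
  (forall x, x != 0 -> {for x, continuous g}) -> ucs M (fun x => f x * g x).
Proof.
move=> fc f0 gc; apply: continuous_ucs => [|x i /KM /f0 ->]; last by rewrite mul0r.
apply: continuous_mul_off0 => //.
by near=> x; apply: f0; near: x.
Unshelve. all: by end_near. Qed.

(** [D] is the partial derivative of |u|^p w. The field component [w] is regular only off the
    origin, but |u|^p vanishes near it, so the product is differentiable everywhere and
    [rv_Rint_derive0] applies. *)
Lemma divergence_int0 k (w dw : 'rV[R]_n -> R) :
  (forall x, x != 0 -> is_derive x (delta_mx 0 k) w (dw x)) ->
  (forall x, x != 0 -> {for x, continuous w}) ->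
  (forall x, x != 0 -> {for x, continuous dw}) ->
  let D := fun x => 'D_(delta_mx 0 k) u x * (p * u x * `|u x| `^ (p - 2)) * w x
    + `|u x| `^ p * dw x in
  ucs M D /\ rv_Rint D = 0.
Proof.
move=> wd wc dwc D.
have p0 : p != 0 by apply: lt0r_neq0; apply: lt_le_trans p2.
have Pc := continuous_powR_test_fun.
have P0 x : ~ K x -> `|u x| `^ p = 0 by move=> /uK ->; rewrite normr0 powR0.
have uD : ucs M D.
  have -> : D = fun x => 1 * ('D_(delta_mx 0 k) u x * (p * u x * `|u x| `^ (p - 2)) * w x)
      + `|u x| `^ p * dw x by apply/funext => x; rewrite mul1r.
  apply: ucs_lin; apply: ucs_mul_off0 => //; last by move=> x /duK ->; rewrite mul0r.
  move=> x; apply: continuous_mulR; first exact: continuous_derive_test_fun.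
  apply: (cvg_comp u (fun s => p * s * `|s| `^ (p - 2)) (@continuous_test_fun x)).
  exact: continuous_norm_powR_derive.
split=> //.
apply: (@rv_Rint_derive0 _ M _ (fun x => `|u x| `^ p * w x) D k) => //.
  exact: ucs_mul_off0.
move=> x; have [->|x0] := eqVneq x 0; last first.
  by apply: is_derive_mulR; [exact: is_derive_powR_test_fun|exact: wd].
have -> : D 0 = 0.
  have nK0 : ~ K 0 := nbhs_singleton K0.
  by rewrite /D (P0 _ nK0) duK// !mul0r addr0.
apply: (@near_eq_is_derive _ _ _ (fun=> 0 : R)).
by near=> y; rewrite P0 ?mul0r//; near: y.
Unshelve. all: by end_near. Qed.

Lemma sum_ucs_int0 (I : Type) (r : seq I) (f : I -> 'rV[R]_n -> R) :
  (forall i, ucs M (f i) /\ rv_Rint (f i) = 0) ->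
  ucs M (fun x => \sum_(i <- r) f i x) /\ rv_Rint (fun x => \sum_(i <- r) f i x) = 0.
Proof.
move=> fi.
have uz : ucs M (fun _ : 'rV[R]_n => 0 : R).
  by apply: continuous_ucs => //; exact: cst_continuous.
elim: r => [|i r [us s0]].
  have -> : (fun x => \sum_(i <- [::]) f i x) = fun=> 0 by apply/funext => x; rewrite big_nil.
  (* Linearity with coefficient -1 expresses the integral of 0 as its own difference with itself. *)
  split=> //; have := rv_Rint_lin M0 (-1) uz uz; rewrite /= mulr0 addr0 => ->.
  by rewrite mulN1r addrC subrr.
have -> : (fun x => \sum_(j <- i :: r) f j x) = fun x => 1 * f i x + \sum_(j <- r) f j x.
  by apply/funext => x; rewrite big_cons mul1r.
have [ui i0] := fi i; split; first exact: ucs_lin.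
by rewrite (rv_Rint_lin M0)// s0 i0 mulr0 addr0.
Qed.

End TestFunctions.

(** * The gauge, the explicit horizontal field, its divergence and its length *)

Section Gauge.
Variables (R : realType) (m : nat) (S J : 'M[R]_m).
Hypothesis HSsym : S^T = S.
Hypothesis HSpd : forall v : 'rV[R]_m, v != 0 -> 0 < (v *m S *m v^T) 0 0.
Implicit Types x v : 'rV[R]_(m + 1).

Definition psi x : R := sdot (zcoord x *m S) (zcoord x) / 4.
Definition gauge4 x : R := psi x ^+ 2 + tcoord x ^+ 2.

Lemma psi_ge0 x : 0 <= psi x.
Proof. by rewrite /psi divr_ge0// sdot_S_ge0. Qed.

Lemma gauge4_ge0 x : 0 <= gauge4 x.
Proof. by rewrite /gauge4 addr_ge0 ?sqr_ge0. Qed.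

Lemma gauge4_gt0 x : x != 0 -> 0 < gauge4 x.
Proof.
move=> x0; rewrite lt_neqAle gauge4_ge0 andbT eq_sym; apply: contra x0.
rewrite paddr_eq0 ?sqr_ge0// !sqrf_eq0 mulf_eq0 invr_eq0 pnatr_eq0 orbF.
rewrite sdot_S_eq0// => /andP[/eqP z0 /eqP t0].
rewrite -[x]hsubmxK -/(zcoord x) z0; have -> : rsubmx x = 0.
  by apply/rowP => i; rewrite (ord1 i) [LHS]t0 mxE.
by rewrite row_mx0.
Qed.

Lemma rhoBE x : rhoB S x = gauge4 x `^ 4^-1.
Proof.
rewrite /rhoB /gauge4 /normB; congr (_ `^ _); congr (_ + _).
rewrite exprMn -[4%N]/(2 * 2)%N !exprM sqr_sqrtr ?sdot_S_ge0// /psi.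
by rewrite /sdot; field.
Qed.

Lemma rhoB_powR x (c : R) : rhoB S x `^ c = gauge4 x `^ (c / 4).
Proof. by rewrite rhoBE -powRrM mulrC. Qed.

Lemma zcoord_line x v h : zcoord (h *: v + x) = h *: zcoord v + zcoord x.
Proof. by rewrite /zcoord linearP. Qed.

Lemma tcoord_line x v h : tcoord (h *: v + x) = h * tcoord v + tcoord x.
Proof. by rewrite /tcoord linearP !mxE. Qed.

Lemma is_derive_psi x v : is_derive x v psi (sdot (zcoord x *m S) (zcoord v) / 2).
Proof.
apply: (@is_derive_quadratic _ _ _ _ _ _ (psi v)) => h.
rewrite /psi zcoord_line mulmxDl -scalemxAl !(sdotDl, sdotDr, sdotZl, sdotZr).
by rewrite (sdot_Ssym HSsym (zcoord v) (zcoord x)); field.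
Qed.

Lemma is_derive_tcoord x v : is_derive x v (@tcoord R m) (tcoord v).
Proof.
by apply: (@is_derive_quadratic _ _ _ _ _ _ 0) => h; rewrite tcoord_line; ring.
Qed.

Lemma is_derive_zcoordM (A : 'M[R]_m) i x v :
  is_derive x v (fun y => (zcoord y *m A) 0 i) ((zcoord v *m A) 0 i).
Proof.
apply: (@is_derive_quadratic _ _ _ _ _ _ 0) => h.
by rewrite zcoord_line mulmxDl -scalemxAl !mxE; ring.
Qed.

Lemma continuous_zcoordM (A : 'M[R]_m) i :
  continuous (fun y : 'rV[R]_(m + 1) => (zcoord y *m A) 0 i).
Proof.
have -> : (fun y : 'rV[R]_(m + 1) => (zcoord y *m A) 0 i) =
    fun y => \sum_j y 0 (lshift 1 j) * A j i.
  by apply/funext => y; rewrite mxE; apply: eq_bigr => j _; rewrite mxE.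
move=> x; apply: continuous_sumR => j; apply: continuous_mulR.
  exact: coord_continuous.
exact: cst_continuous.
Qed.

Lemma continuous_zcoord i : continuous (fun y : 'rV[R]_(m + 1) => zcoord y 0 i).
Proof.
have -> : (fun y : 'rV[R]_(m + 1) => zcoord y 0 i) = fun y => (zcoord y *m 1%:M) 0 i.
  by apply/funext => y; rewrite mulmx1.
exact: continuous_zcoordM.
Qed.

Lemma continuous_tcoord : continuous (@tcoord R m).
Proof.
have -> : @tcoord R m = fun x => x 0 (rshift m ord0).
  by apply/funext => x; rewrite /tcoord mxE.
exact: coord_continuous.
Qed.

Lemma continuous_psi : continuous psi.
Proof.
have -> : psi = fun x => \sum_i (zcoord x *m S) 0 i * zcoord x 0 i / 4.
  by apply/funext => x; rewrite /psi sdotE mulr_suml.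
move=> x; apply: continuous_sumR => i; apply: continuous_mulR; last exact: cst_continuous.
by apply: continuous_mulR; [exact: continuous_zcoordM|exact: continuous_zcoord].
Qed.

Lemma continuous_gauge4 : continuous gauge4.
Proof.
move=> x; apply: continuous_addR; apply: continuous_exprR.
  exact: continuous_psi.
exact: continuous_tcoord.
Qed.

Lemma continuous_gauge4_powR (c : R) x : x != 0 ->
  {for x, continuous (fun y => gauge4 y `^ c)}.
Proof.
by move=> /gauge4_gt0 x0; apply: continuous_powR => //; exact: continuous_gauge4.
Qed.

Lemma gauge4_powR_pred (c : R) x : x != 0 ->
  gauge4 x `^ c = gauge4 x `^ (c - 1) * gauge4 x.
Proof.
move=> /gauge4_gt0 q0; rewrite -[in LHS](subrK 1 c) [LHS]powRD ?powRr1 ?(ltW q0)//.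
by rewrite (gt_eqF q0) implybT.
Qed.

Definition dpsi v x : R := sdot (zcoord x *m S) (zcoord v) / 2.
Definition dgauge4 v x : R := 2 * psi x * dpsi v x + 2 * tcoord x * tcoord v.

Lemma is_derive_gauge4 x v : is_derive x v gauge4 (dgauge4 v x).
Proof.
have -> : gauge4 = fun y => psi y * psi y + tcoord y * tcoord y.
  by apply/funext => y; rewrite /gauge4 !expr2.
have dp := is_derive_psi x v; have dt := is_derive_tcoord x v.
have := is_derive_addR (is_derive_mulR dp dp) (is_derive_mulR dt dt).
congr is_derive; rewrite /dgauge4 /dpsi; ring.
Qed.

Lemma continuous_dpsi v : continuous (dpsi v).
Proof.
have -> : dpsi v = fun x => \sum_i (zcoord x *m S) 0 i * zcoord v 0 i / 2.
  by apply/funext => x; rewrite /dpsi sdotE mulr_suml.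
move=> x; apply: continuous_sumR => i; apply: continuous_mulR; last exact: cst_continuous.
by apply: continuous_mulR; [exact: continuous_zcoordM|exact: cst_continuous].
Qed.

Lemma continuous_dgauge4 v : continuous (dgauge4 v).
Proof.
move=> x; apply: continuous_addR; apply: continuous_mulR.
- by apply: continuous_cmulR; exact: continuous_psi.
- exact: continuous_dpsi.
- by apply: continuous_cmulR; exact: continuous_tcoord.
- exact: cst_continuous.
Qed.

Variables al be : R.

(** With [gauge4] as q, [al] as a / 4 and [be] as b, [fld1] and [fld2] are the coefficients of z and
    J z in the field v. *)
Definition fld1 x : R := gauge4 x `^ al + - be * (gauge4 x `^ (al - 1) * psi x ^+ 2).
Definition fld2 x : R := - be * (gauge4 x `^ (al - 1) * (psi x * tcoord x)).

Definition dfld1 v x : R := dgauge4 v x * (al * gauge4 x `^ (al - 1))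
  + - be * (dgauge4 v x * ((al - 1) * gauge4 x `^ (al - 2)) * psi x ^+ 2
            + gauge4 x `^ (al - 1) * (2 * psi x * dpsi v x)).
Definition dfld2 v x : R :=
  - be * (dgauge4 v x * ((al - 1) * gauge4 x `^ (al - 2)) * (psi x * tcoord x)
          + gauge4 x `^ (al - 1) * (dpsi v x * tcoord x + psi x * tcoord v)).

Lemma is_derive_gauge4_powR c x v : x != 0 ->
  is_derive x v (fun y => gauge4 y `^ c) (dgauge4 v x * (c * gauge4 x `^ (c - 1))).
Proof.
by move=> /gauge4_gt0 x0; apply: is_derive_powR => //; exact: is_derive_gauge4.
Qed.

Lemma is_derive_fld1 x v : x != 0 -> is_derive x v fld1 (dfld1 v x).
Proof.
move=> x0; apply: is_derive_addR; first exact: is_derive_gauge4_powR.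
apply: is_derive_cmulR; apply: is_derive_mulR.
  have := is_derive_gauge4_powR (al - 1) v x0.
  by have -> : al - 1 - 1 = al - 2 by ring.
have -> : (fun y => psi y ^+ 2) = fun y => psi y * psi y.
  by apply/funext => y; rewrite expr2.
have dp := is_derive_psi x v; have := is_derive_mulR dp dp.
by congr is_derive; rewrite -/(dpsi v x); ring.
Qed.

Lemma is_derive_fld2 x v : x != 0 -> is_derive x v fld2 (dfld2 v x).
Proof.
move=> x0; apply: is_derive_cmulR; apply: is_derive_mulR.
  have := is_derive_gauge4_powR (al - 1) v x0.
  by have -> : al - 1 - 1 = al - 2 by ring.
by apply: is_derive_mulR; [exact: is_derive_psi|exact: is_derive_tcoord].
Qed.

Lemma continuous_fld1 x : x != 0 -> {for x, continuous fld1}.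
Proof.
move=> x0; apply: continuous_addR; first exact: continuous_gauge4_powR.
apply: continuous_cmulR; apply: continuous_mulR; first exact: continuous_gauge4_powR.
by apply: continuous_exprR; exact: continuous_psi.
Qed.

Lemma continuous_fld2 x : x != 0 -> {for x, continuous fld2}.
Proof.
move=> x0; apply: continuous_cmulR; apply: continuous_mulR; first exact: continuous_gauge4_powR.
by apply: continuous_mulR; [exact: continuous_psi|exact: continuous_tcoord].
Qed.

Let continuous_dq c v x : x != 0 ->
  {for x, continuous (fun y => dgauge4 v y * (c * gauge4 y `^ (al - 2)))}.
Proof.
move=> x0; apply: continuous_mulR; first exact: continuous_dgauge4.
by apply: continuous_cmulR; exact: continuous_gauge4_powR.
Qed.

Lemma continuous_dfld1 v x : x != 0 -> {for x, continuous (dfld1 v)}.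
Proof.
move=> x0; apply: continuous_addR.
  apply: continuous_mulR; first exact: continuous_dgauge4.
  by apply: continuous_cmulR; exact: continuous_gauge4_powR.
apply: continuous_cmulR; apply: continuous_addR; apply: continuous_mulR.
- exact: continuous_dq.
- by apply: continuous_exprR; exact: continuous_psi.
- exact: continuous_gauge4_powR.
- apply: continuous_mulR; last exact: continuous_dpsi.
  by apply: continuous_cmulR; exact: continuous_psi.
Qed.

Lemma continuous_dfld2 v x : x != 0 -> {for x, continuous (dfld2 v)}.
Proof.
move=> x0; apply: continuous_cmulR; apply: continuous_addR; apply: continuous_mulR.
- exact: continuous_dq.
- by apply: continuous_mulR; [exact: continuous_psi|exact: continuous_tcoord].
- exact: continuous_gauge4_powR.
- apply: continuous_addR; apply: continuous_mulR.
  + exact: continuous_dpsi.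
  + exact: continuous_tcoord.
  + exact: continuous_psi.
  + exact: cst_continuous.
Qed.

Definition hfield x : 'rV[R]_m := fld1 x *: zcoord x + fld2 x *: (zcoord x *m J).

Definition field_z i x : R := fld1 x * zcoord x 0 i + fld2 x * (zcoord x *m J) 0 i.
(* The [dt]-component of the field, [<hfield x, B z> / 2]. *)
Definition field_t x : R := 2 * (psi x * fld2 x).

(** Only the derivative of each component in its own direction is recorded, as the divergence
    involves no other. *)
Definition dfield_z i x : R :=
  dfld1 (dir_z R i) x * zcoord x 0 i + fld1 x
  + (dfld2 (dir_z R i) x * (zcoord x *m J) 0 i + fld2 x * J i i).
Definition dfield_t x : R := 2 * (psi x * dfld2 (dir_t R m) x).

Lemma zcoord_dir_z (i : 'I_m) : zcoord (dir_z R i) = delta_mx 0 i :> 'rV[R]_m.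
Proof.
by apply/rowP => j; rewrite !mxE eqxx/= (inj_eq (@lshift_inj _ _)).
Qed.

Lemma zcoord_dir_t : zcoord (dir_t R m) = 0.
Proof.
by apply/rowP => j; rewrite !mxE eqxx/= eq_lrshift.
Qed.

Lemma tcoord_dir_z (i : 'I_m) : tcoord (dir_z R i) = 0.
Proof. by rewrite /tcoord !mxE eqxx/= eq_rlshift. Qed.

Lemma tcoord_dir_t : tcoord (dir_t R m) = 1.
Proof. by rewrite /tcoord !mxE !eqxx. Qed.

Lemma is_derive_field_z i x : x != 0 -> is_derive x (dir_z R i) (field_z i) (dfield_z i x).
Proof.
move=> x0.
have dz : is_derive x (dir_z R i) (fun y => zcoord y 0 i) 1.
  have := is_derive_zcoordM 1%:M i x (dir_z R i).
  under eq_fun do rewrite mulmx1.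
  by rewrite mulmx1 zcoord_dir_z mxE !eqxx.
have dJ : is_derive x (dir_z R i) (fun y => (zcoord y *m J) 0 i) (J i i).
  have := is_derive_zcoordM J i x (dir_z R i).
  by rewrite zcoord_dir_z -rowE mxE.
have := is_derive_addR (is_derive_mulR (is_derive_fld1 (dir_z R i) x0) dz)
  (is_derive_mulR (is_derive_fld2 (dir_z R i) x0) dJ).
by rewrite mulr1.
Qed.

Lemma is_derive_field_t x : x != 0 -> is_derive x (dir_t R m) field_t (dfield_t x).
Proof.
move=> x0; apply: is_derive_cmulR.
have := is_derive_mulR (is_derive_psi x (dir_t R m)) (is_derive_fld2 (dir_t R m) x0).
by rewrite zcoord_dir_t /sdot trmx0 mulmx0 mxE !mul0r add0r.
Qed.

Lemma continuous_field_z i x : x != 0 -> {for x, continuous (field_z i)}.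
Proof.
move=> x0; apply: continuous_addR; apply: continuous_mulR.
- exact: continuous_fld1.
- exact: continuous_zcoord.
- exact: continuous_fld2.
- exact: continuous_zcoordM.
Qed.

Lemma continuous_field_t x : x != 0 -> {for x, continuous field_t}.
Proof.
move=> x0; apply: continuous_cmulR; apply: continuous_mulR.
  exact: continuous_psi.
exact: continuous_fld2.
Qed.

Lemma continuous_dfield_z i x : x != 0 -> {for x, continuous (dfield_z i)}.
Proof.
move=> x0; apply: continuous_addR; apply: continuous_addR.
- apply: continuous_mulR; first exact: continuous_dfld1.
  exact: continuous_zcoord.
- exact: continuous_fld1.
- apply: continuous_mulR; first exact: continuous_dfld2.
  exact: continuous_zcoordM.
- apply: continuous_mulR; first exact: continuous_fld2.
  exact: cst_continuous.
Qed.

Lemma continuous_dfield_t x : x != 0 -> {for x, continuous dfield_t}.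
Proof.
move=> x0; apply: continuous_cmulR; apply: continuous_mulR.
  exact: continuous_psi.
exact: continuous_dfld2.
Qed.

Hypothesis trJ : \tr J = 0.
Hypothesis JS : forall z : 'rV[R]_m, sdot (z *m J *m S) z = 0.
Hypothesis JSJ : forall z : 'rV[R]_m, sdot (z *m J *m S) (z *m J) = sdot (z *m S) z.

(** The J terms drop out by <S z, J z> = 0 and tr J = 0. The rest is m q^al plus a multiple of 4 al
    - be (4 al + m + 2), which the choice of [be] cancels. *)
Lemma div_field x : x != 0 -> be * (4 * al + m%:R + 2) = 4 * al ->
  \sum_i dfield_z i x + dfield_t x = m%:R * gauge4 x `^ al.
Proof.
move=> x0 beE.
set a2 := gauge4 x `^ (al - 2).
have a1E : gauge4 x `^ (al - 1) = a2 * gauge4 x.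
  by rewrite gauge4_powR_pred// /a2; congr (_ `^ _ * _); ring.
have a0E : gauge4 x `^ al = a2 * gauge4 x ^+ 2.
  by rewrite gauge4_powR_pred// a1E expr2 mulrA.
(* [P1] and [P2] are the partial derivatives of [fld1] and [fld2] in psi at fixed t; the gradient of
   psi in z is S z / 2. *)
pose P1 := 2 * psi x * (al * gauge4 x `^ (al - 1)) - be * (2 * psi x * ((al - 1) * a2) * psi x ^+ 2
  + gauge4 x `^ (al - 1) * (2 * psi x)).
pose P2 := - be * (2 * psi x * ((al - 1) * a2) * (psi x * tcoord x)
          + gauge4 x `^ (al - 1) * tcoord x).
have dz i : dfield_z i x = P1 / 2 * ((zcoord x *m S) 0 i * zcoord x 0 i)
    + (fld1 x + (P2 / 2 * ((zcoord x *m S) 0 i * (zcoord x *m J) 0 i) + fld2 x * J i i)).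
  rewrite /dfield_z /dfld1 /dfld2 /dgauge4 tcoord_dir_z.
  have -> : dpsi (dir_z R i) x = (zcoord x *m S) 0 i / 2.
    by rewrite /dpsi zcoord_dir_z /sdot trmx_delta -colE mxE.
  by rewrite -/a2 /P1 /P2; field.
rewrite (eq_bigr _ (fun i _ => dz i)) big_split/= -mulr_sumr -sdotE.
rewrite big_split/= sumr_const card_ord -mulr_natl big_split/= -!mulr_sumr -sdotE.
rewrite [X in fld2 x * X](_ : _ = 0); last exact: trJ.
rewrite (sdot_Ssym HSsym (zcoord x) (zcoord x *m J)) JS.
have -> : sdot (zcoord x *m S) (zcoord x) = 4 * psi x by rewrite /psi; field.
have -> : dfield_t x = 2 * (psi x * (- be * (2 * tcoord x * ((al - 1) * a2) * (psi x * tcoord x) + gauge4 x `^ (al - 1) * psi x))).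
  rewrite /dfield_t /dfld2 /dgauge4 tcoord_dir_t.
  have -> : dpsi (dir_t R m) x = 0 by rewrite /dpsi zcoord_dir_t /sdot trmx0 mulmx0 mxE mul0r.
  rewrite -/a2; ring.
rewrite /fld1 /P1 a0E a1E.
set P := psi x; set T := tcoord x; rewrite /gauge4 -/P -/T.
set n : R := m%:R in beE *.
transitivity (n * (a2 * (P ^+ 2 + T ^+ 2) ^+ 2) + a2 * (P ^+ 2 + T ^+ 2) * P ^+ 2 * (4 * al - be * (4 * al + n + 2))).
  by field.
by rewrite beE subrr mulr0 addr0.
Qed.

Lemma sdot_hfield_S x :
  sdot (hfield x *m S) (hfield x) = 4 * psi x * (fld1 x ^+ 2 + fld2 x ^+ 2).
Proof.
rewrite /hfield mulmxDl -!scalemxAl !(sdotDl, sdotDr, sdotZl, sdotZr).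
rewrite JS JSJ (sdot_Ssym HSsym (zcoord x)) JS.
have -> : sdot (zcoord x *m S) (zcoord x) = 4 * psi x by rewrite /psi; field.
by ring.
Qed.

(** As psi^2 + t^2 = q, the terms in be^2 add up to be^2 psi^2 q, so a factor q comes out; then 2 be
    - be^2 = 1 - (1 - be)^2. *)
Lemma fld_norm x : x != 0 -> fld1 x ^+ 2 + fld2 x ^+ 2 =
  (gauge4 x `^ (al - 1)) ^+ 2 * (gauge4 x * (gauge4 x - (1 - (1 - be) ^+ 2) * psi x ^+ 2)).
Proof.
move=> x0; rewrite /fld1 /fld2 gauge4_powR_pred//; set a1 := gauge4 x `^ (al - 1).
by rewrite /gauge4; ring.
Qed.

End Gauge.

(** * The Hardy inequality for a single test function *)

Section Core.
Variable R : realType.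

Lemma sdot_CauchySchwarz m (u v : 'rV[R]_m) : sdot u v ^+ 2 <= sdot u u * sdot v v.
Proof.
have [->|v0] := eqVneq v 0.
  by rewrite sdotC /sdot !mul0mx !mxE expr0n mulr0.
have vv : 0 < sdot v v by rewrite lt_neqAle sdot_ge0 eq_sym sdot_eq0 v0.
have := sdot_ge0 (sdot v v *: u + - sdot u v *: v).
rewrite !(sdotDl, sdotDr, sdotZl, sdotZr) (sdotC v u).
have h : 0 <= sdot v v * (sdot u u * sdot v v - sdot u v ^+ 2) ->
    sdot u v ^+ 2 <= sdot u u * sdot v v by rewrite pmulr_rge0// subr_ge0.
by move=> uv; apply: h; move: uv; congr (0 <= _); ring.
Qed.

(** Young's inequality for [a] and b^(p - 1) with exponents p and p / (p - 1), multiplied by [p]. *)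
Lemma Young_powR (p a b : R) : 1 < p -> 0 <= a -> 0 <= b ->
  p * a * b `^ (p - 1) <= a `^ p + (p - 1) * b `^ p.
Proof.
move=> p1 a0 b0.
have p0 : 0 < p by rewrite (lt_trans ltr01).
have pn0 : p != 0 by rewrite gt_eqF.
have q0 : 0 < p - 1 by rewrite subr_gt0.
have qn0 : p - 1 != 0 by rewrite gt_eqF.
have pq : p^-1 + (p / (p - 1))^-1 = 1 by field; rewrite pn0 qn0.
have := conjugate_powR a0 (powR_ge0 b (p - 1)) p0 (divr_gt0 p0 q0) pq.
rewrite -powRrM; have -> : (p - 1) * (p / (p - 1)) = p by field.
move=> /(ler_wpM2l (ltW p0)).
have -> : p * (a `^ p / p + b `^ p / (p / (p - 1))) = a `^ p + (p - 1) * b `^ p.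
  by field; rewrite pn0 qn0.
by rewrite mulrA.
Qed.

Lemma rv_int_ge0 n (f : 'rV[R]_n -> \bar R) : (forall x, 0 <= f x)%E -> (0 <= rv_int f)%E.
Proof.
elim: n f => [|n IH] f f0 /=; first exact: f0.
by apply: integral_ge0 => a _; apply: IH.
Qed.

Lemma BzE m (B : 'M[R]_m) (z : 'rV[R]_m) i : Bz B z i = (z *m B^T) 0 i.
Proof. by rewrite mxE; apply: eq_bigr => j _; rewrite mxE mulrC. Qed.

Variables (m : nat) (B S : 'M[R]_m).
Hypothesis HBskew : B^T = - B.
Hypothesis HSsym : S^T = S.
Hypothesis HSpd : forall v : 'rV[R]_m, v != 0 -> 0 < (v *m S *m v^T) 0 0.
Hypothesis HSsq : S *m S = - (B *m B).
Variables (lam p theta be M0 : R).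
Hypothesis lam0 : 0 < lam.
Hypothesis lamS : forall v : 'rV[R]_m, lam * sdot v v <= sdot (v *m S) v.
Hypothesis p2 : 2 <= p.
Let al : R := - (p * theta / 4).
Hypothesis beE : be * (4 * al + m%:R + 2) = 4 * al.
Hypothesis M00 : 0 < M0.
Hypothesis M0P : forall s, 0 <= s <= 1 -> s * (1 - (1 - (1 - be) ^+ 2) * s ^+ 2) <= M0.

Let J := Jmx B S.
Let Mv : R := 2 * Num.sqrt (M0 / lam).
Let v x := hfield S J al be x.
Let q x := gauge4 S x.

Let Mv0 : 0 < Mv.
Proof. by rewrite mulr_gt0// sqrtr_gt0 divr_gt0. Qed.

Let p0 : 0 < p. Proof. exact: lt_le_trans p2. Qed.

(** In terms of s = psi / sqrt q, <v, S v> is 4 q^(2 al) sqrt q times the profile bounded by [M0];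
    dividing by [lam] and taking roots gives [Mv]. *)
Lemma norm_hfield_le x : x != 0 ->
  Num.sqrt (sdot (v x) (v x)) <= Mv * q x `^ (al + 4^-1).
Proof.
move=> x0; have q0 : 0 < q x by exact: gauge4_gt0.
have N0 : 0 <= Mv * q x `^ (al + 4^-1) by rewrite mulr_ge0 ?powR_ge0 ?ltW.
rewrite -(ger0_norm N0) -sqrtr_sqr ler_wsqrtr//.
have E : (Mv * q x `^ (al + 4^-1)) ^+ 2 = 4 * (M0 / lam) * ((q x `^ al) ^+ 2 * Num.sqrt (q x)).
  rewrite powRD; last by rewrite (gt_eqF q0) implybT.
  have -> : Num.sqrt (q x) = (q x `^ 4^-1) ^+ 2.
    rewrite -powR12_sqrt ?(ltW q0)// -powR_mulrn ?powR_ge0// -powRrM.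
    by congr (_ `^ _); field.
  rewrite !exprMn sqr_sqrtr; last by rewrite divr_ge0 ?ltW.
  by rewrite /Mv; ring.
rewrite E -(ler_pM2l lam0); apply: (le_trans (lamS _)).
rewrite /v sdot_hfield_S//; [|exact: sdot_Jmx_S|exact: sdot_Jmx_S_Jmx].
rewrite fld_norm// -/(q x) [in leRHS]gauge4_powR_pred// -/(q x).
set a1 := q x `^ (al - 1); set sg := Num.sqrt (q x).
have sg0 : 0 < sg by rewrite sqrtr_gt0.
have qE : q x = sg ^+ 2 by rewrite sqr_sqrtr// ltW.
have ps0 := psi_ge0 HSpd x.
(* At most 1 because psi^2 is one of the two summands of q. *)
have s01 : 0 <= psi S x / sg <= 1.
  rewrite divr_ge0 ?(ltW sg0)//= ler_pdivrMr// mul1r.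
  rewrite -(ger0_norm ps0) -sqrtr_sqr ler_wsqrtr//.
  by rewrite /q /gauge4 lerDl sqr_ge0.
have := M0P s01.
set s := psi S x / sg => sM.
have -> : psi S x = s * sg by rewrite divfK// gt_eqF.
rewrite qE.
have -> : lam * (4 * (M0 / lam) * ((a1 * sg ^+ 2) ^+ 2 * sg)) =
    (4 * a1 ^+ 2 * sg ^+ 5) * M0 by field; rewrite gt_eqF.
have -> : 4 * (s * sg) * (a1 ^+ 2 * (sg ^+ 2 * (sg ^+ 2 - (1 - (1 - be) ^+ 2) * (s * sg) ^+ 2)))
  = (4 * a1 ^+ 2 * sg ^+ 5) * (s * (1 - (1 - (1 - be) ^+ 2) * s ^+ 2)) by ring.
by rewrite ler_wpM2l// mulr_ge0 ?exprn_ge0 ?(ltW sg0)// mulr_ge0 ?sqr_ge0.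
Qed.

Variable u : 'rV[R]_(m + 1) -> R.

Let X x : 'rV[R]_m := \row_i Xfield B i u x.

Lemma hgrad_normE x : hgrad_norm B u x = Num.sqrt (sdot (X x) (X x)).
Proof.
by rewrite /hgrad_norm sdotE; congr Num.sqrt; apply: eq_bigr => i _; rewrite !mxE expr2.
Qed.

(** The horizontal derivative of [u] along v, rewritten in Euclidean coordinates: the t-components
    collect into <v, B z> / 2, where only J z contributes since <z, B z> = 0. *)
Lemma sdot_hfield_X x : sdot (v x) (X x) =
  \sum_i 'D_(dir_z R i) u x * field_z S J al be i x
  + 'D_(dir_t R m) u x * field_t S al be x.
Proof.
have -> : field_t S al be x = 2^-1 * sdot (v x) (zcoord x *m B^T).
  rewrite /v /hfield sdotDl !sdotZl sdot_skew// sdot_Jmx_B//.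
  by rewrite /field_t /psi; field.
rewrite mulrCA -[_ * sdot _ _]sdotZr !sdotE mulr_sumr -big_split/=.
apply: eq_bigr => i _; rewrite /field_z /X !mxE /Xfield BzE.
by rewrite /v /hfield !mxE; ring.
Qed.

Let P x : R := `|u x| `^ p.
Let dP x : R := p * u x * `|u x| `^ (p - 2).

(** Euclidean divergence of |u|^p v, each coordinate in the shape integrated by
    [divergence_int0]. *)
Let divergence x : R :=
  \sum_i ('D_(dir_z R i) u x * dP x * field_z S J al be i x + P x * dfield_z S J al be i x)
  + ('D_(dir_t R m) u x * dP x * field_t S al be x + P x * dfield_t S al be x).

Lemma divergenceE x : x != 0 ->
  divergence x = dP x * sdot (v x) (X x) + P x * (m%:R * q x `^ al).
Proof.
move=> x0; rewrite /q -(@div_field _ _ S J HSsym HSpd al be _ _ _ x0 beE); last first.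
- exact: sdot_Jmx_S.
- exact: tr_Jmx.
rewrite sdot_hfield_X /divergence big_split/= !mulrDr !mulr_sumr.
under eq_bigr do rewrite mulrAC mulrC.
by rewrite [_ * dP x]mulrC -!mulrA; ring.
Qed.

(** The maximiser of c^(p - 1) m / Mv - (p - 1) c^p over c >= 0; the maximum is r^p. *)
Let r : R := m%:R / (p * Mv).

(** Cauchy-Schwarz bounds the term of the divergence containing the gradient, and Young's inequality
    splits it with a = |grad u| q^((al + p / 4) / p) and b = r |u| q^(al / p); the powers of q in a
    b^(p - 1) combine to al + 1/4. *)
Lemma pointwise_Hardy x : x != 0 ->
  r `^ p * (P x * q x `^ al) - r `^ (p - 1) / Mv * divergence x
  <= `|hgrad_norm B u x| `^ p * q x `^ (al + p / 4).
Proof.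
move=> x0; have q0 : 0 < q x by exact: gauge4_gt0.
have pn0 : p != 0 by rewrite gt_eqF.
have Mvn0 : Mv != 0 by rewrite gt_eqF.
rewrite divergenceE//.
have r0 : 0 <= r by rewrite divr_ge0 ?ler0n// mulr_ge0// ltW.
have p1 : 1 < p by apply: lt_le_trans p2; rewrite ltr1n.
set h := hgrad_norm B u x.
have h0 : 0 <= h by rewrite sqrtr_ge0.
set U := `|u x|; have U0 : 0 <= U by exact: normr_ge0.
have Xle : - (dP x * sdot (v x) (X x)) <= p * U `^ (p - 1) * (Mv * q x `^ (al + 4^-1)) * h.
  apply: le_trans (ler_norm _) _; rewrite normrN normrM -mulrA ler_pM//.
    rewrite /dP !normrM (gtr0_norm p0) -/U (ger0_norm (powR_ge0 _ _)) -mulrA.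
    rewrite ler_wpM2l ?(ltW p0)//.
    have -> : p - 2 = p - 1 - 1 by ring.
    by rewrite mulr_powRB1// subr_gt0.
  rewrite -sqrtr_sqr; apply: (le_trans (ler_wsqrtr (sdot_CauchySchwarz _ _))).
  rewrite sqrtrM ?sdot_ge0// -hgrad_normE -/h ler_wpM2r//.
  exact: norm_hfield_le.
have a0 : 0 <= h * q x `^ ((al + p / 4) / p) by rewrite mulr_ge0 ?powR_ge0.
have b0 : 0 <= r * U * q x `^ (al / p) by apply: mulr_ge0; [exact: mulr_ge0|exact: powR_ge0].
have := Young_powR p1 a0 b0.
have rU0 : 0 <= r * U by exact: mulr_ge0.
rewrite (powRM p h0 (powR_ge0 _ _)) !(powRM _ rU0 (powR_ge0 _ _)) !(powRM _ r0 U0) -!powRrM.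
have -> : (al + p / 4) / p * p = al + p / 4 by field.
have -> : al / p * p = al by field.
have -> : al / p * (p - 1) = al - al / p by field.
rewrite (ger0_norm h0) -/(P x).
have -> : p * (h * q x `^ ((al + p / 4) / p)) * (r `^ (p - 1) * U `^ (p - 1) * q x `^ (al - al / p))
    = r `^ (p - 1) / Mv * (p * U `^ (p - 1) * (Mv * q x `^ (al + 4^-1)) * h).
  have -> : q x `^ (al + 4^-1) = q x `^ ((al + p / 4) / p) * q x `^ (al - al / p).
    rewrite -powRD; last by rewrite (gt_eqF q0) implybT.
    by congr (_ `^ _); field.
  by field.
have k0 : 0 <= r `^ (p - 1) / Mv by rewrite divr_ge0 ?powR_ge0// ltW.
have := ler_wpM2l k0 Xle.
have rp : r `^ p = r `^ (p - 1) * r by rewrite mulrC mulr_powRB1.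
(* The divergence supplies p r^p |u|^p q^al, of which Young's inequality consumes p - 1 parts; one
   part is left. *)
have km : r `^ (p - 1) / Mv * m%:R = p * r `^ p.
  by rewrite rp /r; field; rewrite pn0 Mvn0.
rewrite ?(_ : U `^ p = P x) //.
set k := r `^ (p - 1) / Mv in km *.
set T := k * _; set qa := q x `^ al; set Z := dP x * _.
have -> : k * (Z + P x * (m%:R * qa)) = k * Z + p * r `^ p * (P x * qa) by rewrite -km; ring.
rewrite mulrN; set G := h `^ p * _ => h1 h2.
rewrite [r `^ p * P x * qa](_ : _ = r `^ p * (P x * qa)) in h2; last by rewrite mulrA.
lra.
Qed.

(** Integrating [pointwise_Hardy] removes the divergence. In powers of q the two weights have
    exponents al and al + p / 4, and all integrands are [ucs] because [u] vanishes near the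
    origin. *)
Lemma Hardy_test_fun : test_fun u ->
  ((r `^ p)%:E * rv_int (fun x => ((`| u x | `^ p) / (rhoB S x `^ (p * theta)))%:E)
         <= rv_int (fun x => ((hgrad_norm B u x `^ p) /
                               (rhoB S x `^ (p * (theta - 1))))%:E))%E.
Proof.
move=> [usm [K [cK K0' uK]]].
have [[M M_0 KM] [nK duK]] := test_fun_support cK uK.
have K0 := nK _ K0'.
have pn0 : p != 0 by rewrite gt_eqF.
have h0 x : ~ K x -> hgrad_norm B u x = 0.
  move=> Kx; rewrite /hgrad_norm big1 ?sqrtr0// => i _.
  by rewrite /Xfield !duK// mulr0 addr0 expr0n.
have -> : (fun x => ((`| u x | `^ p) / (rhoB S x `^ (p * theta)))%:E) =
    (fun x => (P x * q x `^ al)%:E).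
  by apply/funext => x; rewrite rhoB_powR// -powRN.
have -> : (fun x => ((hgrad_norm B u x `^ p) / (rhoB S x `^ (p * (theta - 1))))%:E) =
    (fun x => (`|hgrad_norm B u x| `^ p * q x `^ (al + p / 4))%:E).
  apply/funext => x; rewrite rhoB_powR// -powRN ger0_norm ?sqrtr_ge0//.
  by congr (_ * _ `^ _)%:E; rewrite /al; field.
have u2 : ucs M (fun x => P x * q x `^ al).
  apply: (ucs_mul_off0 KM K0).
  - exact: continuous_powR_test_fun.
  - by move=> x /uK; rewrite /P => ->; rewrite normr0 powR0.
  - by move=> x; exact: continuous_gauge4_powR.
have u1 : ucs M (fun x => `|hgrad_norm B u x| `^ p * q x `^ (al + p / 4)).
  apply: (ucs_mul_off0 KM K0).
  - move=> x; have Xc : {for x, continuous (fun y => \sum_(i < m) Xfield B i u y ^+ 2)}.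
      apply: continuous_sumR => i; apply: continuous_exprR; apply: continuous_addR.
        exact: continuous_derive_test_fun.
      apply: continuous_mulR; last exact: continuous_derive_test_fun.
      apply: continuous_cmulR.
      have -> : (fun y : 'rV[R]_(m + 1) => Bz B (zcoord y) i) = fun y => (zcoord y *m B^T) 0 i.
        by apply/funext => y; rewrite BzE.
      exact: continuous_zcoordM.
    have hc : {for x, continuous (hgrad_norm B u)} := cvg_comp (fun y => \sum_(i < m) Xfield B i u y ^+ 2) Num.sqrt Xc (@sqrt_continuous R _).
    have pc : {for hgrad_norm B u x, continuous (fun s : R => `|s| `^ p)} := @continuous_normR_powR R p p2 _.
    exact: (cvg_comp (hgrad_norm B u) (fun s : R => `|s| `^ p) hc pc).
  - by move=> x /h0 ->; rewrite normr0 powR0.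
  - by move=> x; exact: continuous_gauge4_powR.
rewrite (rv_int_EFin M_0 u2) (rv_int_EFin M_0 u1) -EFinM lee_fin.
have [uD D0] : ucs M divergence /\ rv_Rint divergence = 0.
  have [us s0] := @sum_ucs_int0 R _ M M_0 _ (index_enum 'I_m) _ (fun i =>
    @divergence_int0 R _ p u K M p2 usm M_0 KM uK duK K0 (lshift 1 i) _ _
      (fun x => @is_derive_field_z _ _ S J HSsym HSpd al be i x)
      (fun x => @continuous_field_z _ _ S J HSpd al be i x)
      (fun x => @continuous_dfield_z _ _ S J HSpd al be i x)).
  have [ut t0] := @divergence_int0 R _ p u K M p2 usm M_0 KM uK duK K0 (rshift m ord0) _ _
      (fun x => @is_derive_field_t _ _ S HSsym HSpd al be x)
      (fun x => @continuous_field_t _ _ S HSpd al be x)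
      (fun x => @continuous_dfield_t _ _ S HSpd al be x).
  have := ucs_lin 1 us ut; have := rv_Rint_lin M_0 1 us ut.
  rewrite s0 t0 mulr0 addr0.
  by under eq_fun do rewrite mul1r.
pose k := r `^ (p - 1) / Mv.
(* This is -k times the divergence, put in the form c f + g handled by the linearity lemmas. *)
have uE : ucs M (fun x => (- k - 1) * divergence x + divergence x) by exact: ucs_lin.
have E0 : rv_Rint (fun x => (- k - 1) * divergence x + divergence x) = 0.
  by rewrite (rv_Rint_lin M_0)// D0 mulr0 addr0.
rewrite -[leLHS]addr0 -E0 -(rv_Rint_lin M_0)//.
apply: (le_rv_Rint M_0) => //; first exact: ucs_lin.
(* At the origin, where the field is not controlled, |u|^p and the divergence both vanish. *)
move=> x; have [->|x0] := eqVneq x 0; last first.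
  by have := pointwise_Hardy x0; rewrite -/k; congr (_ <= _); ring.
have Z : P 0 = 0 by rewrite /P uK// normr0 powR0.
have -> : divergence 0 = 0.
  rewrite /divergence Z duK// big1 => [|i _]; last by rewrite duK// !mul0r addr0.
  by rewrite !mul0r !addr0.
by rewrite Z mul0r !mulr0 !addr0 mulr_ge0 ?powR_ge0.
Qed.

End Core.

(** * Maximisation of the profile s (1 - (1 - g) s^2) *)

Section Constants.
Variable R : realType.

(** The bound is the value at s = 1, so 1 - s divides the difference; the cofactor is nonnegative on
    the unit interval once g >= 2/3. *)
Lemma profile_le_large (g s : R) : 2 / 3 <= g -> 0 <= s <= 1 ->
  s * (1 - (1 - g) * s ^+ 2) <= g.
Proof.
move=> g23 /andP[s0 s1]; rewrite -subr_ge0.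
have -> : g - s * (1 - (1 - g) * s ^+ 2) = (1 - s) * (g * (1 + s + s ^+ 2) - s * (1 + s)) by ring.
rewrite mulr_ge0 ?subr_ge0//.
nra.
Qed.

(** The critical point is s = 1 / k with k = sqrt (3 (1 - g)), and the bound is the value there; the
    difference has a double root at that point. *)
Lemma profile_le_small (g s : R) : g < 1 -> 0 <= s ->
  s * (1 - (1 - g) * s ^+ 2) <= 2 / 3 / Num.sqrt (3 * (1 - g)).
Proof.
move=> g1 s0; set k := Num.sqrt (3 * (1 - g)).
have k0 : 0 < k by rewrite sqrtr_gt0 mulr_gt0// subr_gt0.
have kE : 1 - g = k ^+ 2 / 3.
  rewrite sqr_sqrtr; first by field.
  by rewrite mulr_ge0// subr_ge0 ltW.
rewrite kE ler_pdivlMr// -subr_ge0.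
have -> : 2 / 3 - s * (1 - k ^+ 2 / 3 * s ^+ 2) * k = (s * k - 1) ^+ 2 * (s * k + 2) / 3 by field.
by rewrite divr_ge0// mulr_ge0 ?sqr_ge0// addr_ge0// mulr_ge0// ltW.
Qed.

(** With D = Q - p theta, the interval of the theorem becomes D^2 <= 3/2 Q^2, which for nonzero D is
    the threshold (Q / D)^2 >= 2/3 of the profile. *)
Lemma ratio_sq_le (Q D : R) : 0 < Q ->
  ((1 - Num.sqrt (3 / 2)) * Q <= Q - D) && (Q - D <= (1 + Num.sqrt (3 / 2)) * Q) =
  (D ^+ 2 <= 3 / 2 * Q ^+ 2).
Proof.
move=> Q0; set k := Num.sqrt (3 / 2).
have k0 : 0 <= k by rewrite sqrtr_ge0.
have -> : 3 / 2 = k ^+ 2 by rewrite sqr_sqrtr.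
rewrite -exprMn -[D ^+ 2]real_normK ?num_real// ler_sqr ?nnegrE ?mulr_ge0 ?(ltW Q0)//.
rewrite ler_norml; apply/andP/andP => -[h1 h2]; split; nra.
Qed.

End Constants.

(** * From the field to the explicit lower bounds *)

Section Bound.
Variables (R : realType) (m : nat) (B S : 'M[R]_m).
Hypothesis HBskew : B^T = - B.
Hypothesis HSsym : S^T = S.
Hypothesis HSpd : forall v : 'rV[R]_m, v != 0 -> 0 < (v *m S *m v^T) 0 0.
Hypothesis HSsq : S *m S = - (B *m B).
Variable lam : R.
Hypothesis Hlam : eigenvalue S lam.
Hypothesis Hlammin : forall mu : R, eigenvalue S mu -> lam <= mu.

Lemma posdef_eigenvalue_gt0 : 0 < lam.
Proof.
have /eigenvalueP[w wS w0] := Hlam; have := HSpd w0.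
rewrite wS -/(sdot _ _) sdotZl pmulr_lgt0//.
by rewrite lt_neqAle sdot_ge0 eq_sym sdot_eq0 w0.
Qed.

Lemma dim_gt0 : 0 < m%:R :> R.
Proof.
have /eigenvalueP[w _ w0] := Hlam; rewrite ltr0n lt0n.
apply: contra w0 => /eqP m0; apply/eqP/rowP => -[i im].
by exfalso; move: im; rewrite m0.
Qed.

Lemma hardy_const_ge p theta M0 (Q D : R) : 2 <= p ->
  Q = m%:R + 2 -> D = Q - p * theta -> D != 0 -> 0 < M0 ->
  (forall s, 0 <= s <= 1 -> s * (1 - (1 - (Q / D) ^+ 2) * s ^+ 2) <= M0) ->
  (((m%:R / (p * (2 * Num.sqrt (M0 / lam)))) `^ p)%:E <= hardy_const B (rhoB S) p theta)%E.
Proof.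
move=> p2 QE DE D0 M00 M0P; apply: ereal_sup_ubound.
exists ((m%:R / (p * (2 * Num.sqrt (M0 / lam)))) `^ p) => //; split.
  exact: powR_ge0.
(* This is b = a / D, as the divergence identity demands; then 1 - be = Q / D, and the profile
   parameter is g = (Q / D)^2. *)
pose be := - (p * theta) / D.
have beD : 1 - be = Q / D.
  by apply: (mulIf D0); rewrite mulrBl /be !divfK// mul1r DE; ring.
move=> u; apply: (@Hardy_test_fun R m B S HBskew HSsym HSpd HSsq lam p theta be M0) => //.
- exact: posdef_eigenvalue_gt0.
- exact: Rayleigh_min.
- have -> : 4 * - (p * theta / 4) = - (p * theta) by field.
  have -> : - (p * theta) + m%:R + 2 = D by rewrite DE QE; ring.
  by rewrite /be divfK.
- by rewrite beD.
Qed.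

(** Covers D = 0, where [be] cannot be chosen and the claimed bound is 0. *)
Lemma hardy_const_ge0 p theta : (0 <= hardy_const B (rhoB S) p theta)%E.
Proof.
apply: ereal_sup_ubound; exists 0 => //; split => // u _.
rewrite mul0e; apply: rv_int_ge0 => x.
by rewrite lee_fin divr_ge0 ?powR_ge0.
Qed.

Lemma hardy_const_rhoB_ge p theta (Q : R) : 2 <= p -> Q = m%:R + 2 ->
  ((if ((1 - Num.sqrt (3 / 2)) * Q <= p * theta) &&
       (p * theta <= (1 + Num.sqrt (3 / 2)) * Q)
    then (lam / 4) `^ (p / 2) * `| (Q - p * theta) / p | `^ p
         * `| (Q - 2) / Q | `^ p
    else (lam / 4) `^ (p / 2) * (3 / 2) `^ (p / 2)
         * (3 * (p * theta) * (p * theta - 2 * Q)) `^ (p / 4)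
         / `| p * theta - Q | `^ (p / 2)
         * `| (Q - 2) / p | `^ p)%:E
   <= hardy_const B (rhoB S) p theta)%E.
Proof.
move=> p2 QE; have lam0 := posdef_eigenvalue_gt0; have m0 := dim_gt0.
have p0 : 0 < p by exact: lt_le_trans p2.
have Q0 : 0 < Q by rewrite QE addr_gt0.
have Qm : Q - 2 = m%:R by rewrite QE addrK.
pose D := Q - p * theta.
have ptE : p * theta = Q - D by rewrite /D; ring.
rewrite Qm ptE ratio_sq_le// -ptE -/D.
have l40 : 0 <= lam / 4 by rewrite divr_ge0// ltW.
case: ifPn => [DQ|].
  have [DE|D0] := eqVneq D 0.
    rewrite DE mul0r normr0 powR0 ?mulr0 ?mul0r ?hardy_const_ge0//.
    by rewrite gt_eqF.
  have Dn : 0 < `|D| by rewrite normr_gt0.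
  have D2 : 0 < D ^+ 2 by rewrite exprn_even_gt0.
  have M0 : 0 < (Q / D) ^+ 2 by rewrite expr_div_n divr_gt0// exprn_gt0.
  have g23 : 2 / 3 <= (Q / D) ^+ 2.
    rewrite expr_div_n ler_pdivlMr//; move: DQ; lra.
  apply: le_trans (hardy_const_ge p2 QE erefl D0 M0 (fun s => profile_le_large g23)).
  rewrite lee_fin.
  have -> : (lam / 4) `^ (p / 2) = Num.sqrt (lam / 4) `^ p.
    by rewrite -powR12_sqrt// -powRrM; congr (_ `^ _); field.
  rewrite -(powRM p (sqrtr_ge0 _) (normr_ge0 _)).
  rewrite -(powRM p (mulr_ge0 (sqrtr_ge0 _) (normr_ge0 _)) (normr_ge0 _)).
  rewrite le_eqVlt; apply/orP; left; apply/eqP; congr (_ `^ _).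
  rewrite !normf_div (gtr0_norm p0) (gtr0_norm Q0) (gtr0_norm m0).
  have -> : Num.sqrt ((Q / D) ^+ 2 / lam) = Q / `|D| / Num.sqrt lam.
    by rewrite sqrtrM ?sqr_ge0// sqrtr_sqr sqrtrV ?(ltW lam0)// normf_div (gtr0_norm Q0).
  have -> : Num.sqrt (lam / 4) = Num.sqrt lam / 2.
    rewrite sqrtrM ?(ltW lam0)// sqrtrV//; congr (_ / _).
    by rewrite (_ : 4 = 2 ^+ 2 :> R) ?sqrtr_sqr ?ger0_norm//; ring.
  have sl : 0 < Num.sqrt lam by rewrite sqrtr_gt0.
  by field; rewrite !gt_eqF.
rewrite -ltNge => DQ.
have D2 : 0 < D ^+ 2 by apply: lt_trans DQ; rewrite mulr_gt0// exprn_gt0.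
have D0 : D != 0 by apply/eqP => D0; move: D2; rewrite D0 expr0n ltxx.
have Dn : 0 < `|D| by rewrite normr_gt0.
(* Outside the interval g is even below 2/3, but the interior maximum bounds the profile as soon as
   g < 1. *)
have g1 : (Q / D) ^+ 2 < 1.
  by rewrite expr_div_n ltr_pdivrMr// mul1r; apply: lt_trans DQ; have := exprn_gt0 2 Q0; lra.
set w := Num.sqrt (3 * (1 - (Q / D) ^+ 2)).
have w0 : 0 < w by rewrite sqrtr_gt0 mulr_gt0// subr_gt0.
have M0 : 0 < 2 / 3 / w by rewrite !divr_gt0.
apply: le_trans (@hardy_const_ge p theta (2 / 3 / w) Q D p2 QE erefl D0 M0 _); last first.
  by move=> s /andP[s0 _]; exact: profile_le_small.
rewrite lee_fin.
have half (a : R) : 0 <= a -> a `^ (p / 2) = Num.sqrt a `^ p.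
  by move=> a0; rewrite -powR12_sqrt// -powRrM; congr (_ `^ _); field.
(* Substituting p theta = Q - D turns 3 p theta (p theta - 2 Q) into 3 (D^2 - Q^2) = (w |D|)^2. *)
have E : (3 * (p * theta) * (p * theta - 2 * Q)) `^ (p / 4) / `|p * theta - Q| `^ (p / 2) = w `^ (p / 2).
  have -> : 3 * (p * theta) * (p * theta - 2 * Q) = (w * `|D|) ^+ 2.
    rewrite exprMn real_normK ?num_real// sqr_sqrtr; last by rewrite mulr_ge0// subr_ge0 ltW.
    by rewrite ptE; field.
  have -> : p / 4 = 2^-1 * (p / 2) by field.
  have -> : `|p * theta - Q| = `|D| by rewrite distrC.
  rewrite powRrM powR12_sqrt ?sqr_ge0// sqrtr_sqr ger0_norm ?mulr_ge0 ?(ltW w0)//.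
  by rewrite powRM ?(ltW w0)// mulfK// powR_eq0 gt_eqF.
rewrite -(mulrA _ (_ `^ (p / 4))) E.
have q23 : 0 <= (3 / 2 : R) by rewrite divr_ge0.
rewrite -(powRM _ l40 q23) -(powRM _ (mulr_ge0 l40 q23) (ltW w0)).
rewrite half; last by rewrite !mulr_ge0// ltW.
rewrite -(powRM p (sqrtr_ge0 _) (normr_ge0 _)).
rewrite le_eqVlt; apply/orP; left; apply/eqP; congr (_ `^ _).
set z := 2 / 3 / w / lam.
have z0 : 0 < Num.sqrt z by rewrite sqrtr_gt0 divr_gt0.
have -> : lam / 4 * (3 / 2) * w = (2 * Num.sqrt z)^-1 ^+ 2.
  rewrite exprVn exprMn sqr_sqrtr; last by rewrite ltW// divr_gt0.
  by rewrite /z; field; rewrite !gt_eqF.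
rewrite sqrtr_sqr ger0_norm; last by rewrite invr_ge0 mulr_ge0// ltW.
rewrite normf_div (gtr0_norm p0) (gtr0_norm m0).
by field; rewrite !gt_eqF.
Qed.

End Bound.

(** * The general bound and its specialisation to p = 2, theta = 1 *)

Unset Implicit Arguments.

Theorem theorem1p7 (R : realType) (m : nat) (B : 'M[R]_m)
  (HBskew : B^T = - B)
  (HBker : forall v : 'rV[R]_m, v *m B = 0 -> v = 0)
  (S : 'M[R]_m)
  (HSsym : S^T = S)
  (HSpd : forall v : 'rV[R]_m, v != 0 -> 0 < (v *m S *m v^T) 0 0)
  (HSsq : S *m S = - (B *m B))
  (lam : R)
  (Hlam : eigenvalue S lam)
  (Hlammin : forall mu : R, eigenvalue S mu -> lam <= mu)
  (p theta : R) (Hp : 2 <= p) :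
  let Q : R := m%:R + 2 in
  ((if ((1 - Num.sqrt (3 / 2)) * Q <= p * theta) &&
       (p * theta <= (1 + Num.sqrt (3 / 2)) * Q)
    then (lam / 4) `^ (p / 2) * `| (Q - p * theta) / p | `^ p
         * `| (Q - 2) / Q | `^ p
    else (lam / 4) `^ (p / 2) * (3 / 2) `^ (p / 2)
         * (3 * (p * theta) * (p * theta - 2 * Q)) `^ (p / 4)
         / `| p * theta - Q | `^ (p / 2)
         * `| (Q - 2) / p | `^ p)%:E
   <= hardy_const B (rhoB S) p theta)%E
  /\
  ((lam / 4 * ((Q - 2) ^+ 4 / (4 * Q ^+ 2)))%:E
   <= hardy_const B (rhoB S) 2 1)%E.
Proof.
have key p' th := @hardy_const_rhoB_ge R m B S HBskew HSsym HSpd HSsq lam Hlam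
  Hlammin p' th (m%:R + 2).
move=> Q; split; first exact: key.
have := key 2 1 (lexx 2) erefl; rewrite -/Q.
have Q2 : 2 <= Q by rewrite /Q lerDr.
(* Together with Q >= 2 this places p theta = 2 in the interval, so the first case applies. *)
have sq : 1 <= Num.sqrt (3 / 2 : R).
  rewrite -[leLHS]sqrtr1 ler_wsqrtr// ler_pdivlMr// mul1r.
  by rewrite ler_nat.
have -> : (1 - Num.sqrt (3 / 2)) * Q <= 2 * 1 by nra.
have -> : 2 * 1 <= (1 + Num.sqrt (3 / 2)) * Q by nra.
apply: le_trans; rewrite lee_fin.
have lam0 := posdef_eigenvalue_gt0 HSpd Hlam.
have Q0 : Q != 0 by rewrite gt_eqF// (lt_le_trans _ Q2).
have l4 : 0 <= lam / 4 by rewrite divr_ge0// ltW.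
rewrite divff// (powRr1 l4) !powR_mulrn// !real_normK ?num_real//.
by rewrite le_eqVlt; apply/orP; left; apply/eqP; field.
Qed.
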